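(* Let $\phi=(M,c)$ be a qubit channel (completely positive, trace-preserving) in Bloch representation. Then $\phi$ is entanglement-saving if and only if one of the following holds. (1) There exist $O\in SO(3)$, $\theta\in\mathbb R$, $0<\lambda\le 1$, $\lambda^2\le\mu\le 1$ and $\alpha\ge 0$ with $\alpha^2\le(1-\mu)(\mu-\lambda^2)$ such that $$M=O\begin{pmatrix}\lambda\cos\theta&\lambda\sin\theta&\alpha\\-\lambda\sin\theta&\lambda\cos\theta&0\\0&0&\mu\end{pmatrix}O^T,\qquad c=O\begin{pmatrix}-\alpha\\0\\1-\mu\end{pmatrix}.$$ (2) $c=0$ and there exist $O\in SO(3)$, $\theta\in\mathbb R$, $0<\lambda\le 1$ such that $$M=O\begin{pmatrix}\lambda\cos\theta&\lambda\sin\theta&0\\ \lambda\sin\theta&-\lambda\cos\theta&0\\0&0&-1\end{pmatrix}O^T .$$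
   Context: Bloch representation: a qubit state is $\frac{\mathbb 1+\vec r\cdot\vec\sigma}{2}$ with $\vec r\in\mathbb R^3$, $|\vec r|\le1$, $\vec\sigma=(X,Y,Z)$ the Pauli matrices; a trace-preserving qubit map is denoted $(M,c)$, $M\in\mathcal M(3;\mathbb R)$, $c\in\mathbb R^3$, if it sends $\frac{\mathbb 1+\vec r\cdot\vec\sigma}{2}\mapsto\frac{\mathbb 1+(M\vec r+c)\cdot\vec\sigma}{2}$. A channel is entanglement-breaking if $(\phi\otimes I)(\rho)$ is separable for every bipartite state $\rho$; it is entanglement-saving if $\phi^n$ is not entanglement-breaking for all integers $n\ge1$. *)

(* Defs.v *)
(* The complex numbers are modelled by an arbitrary
   numClosedFieldType C (e.g. algC, or the complex numbers); the reals are
   the elements x with x \is Num.real. *)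
From HB Require Import structures.
From mathcomp Require Import all_boot all_order all_algebra.
Set Implicit Arguments. Unset Strict Implicit. Unset Printing Implicit Defensive.
Import Order.TTheory GRing.Theory Num.Theory.
Local Open Scope ring_scope.

Section Qubit.
Variable C : numClosedFieldType.

(* explicit small matrices *)
Definition mk2 (a b c d : C) : 'M[C]_2 :=
  \matrix_(i, j) if val i == 0%N then (if val j == 0%N then a else b)
                 else (if val j == 0%N then c else d).

Definition mk3 (a11 a12 a13 a21 a22 a23 a31 a32 a33 : C) : 'M[C]_3 :=
  \matrix_(i, j)
    match val i, val j with
    | 0, 0 => a11 | 0, 1 => a12 | 0, _ => a13
    | 1, 0 => a21 | 1, 1 => a22 | 1, _ => a23
    | _, 0 => a31 | _, 1 => a32 | _, _ => a33
    end%N.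

Definition col3 (x y z : C) : 'cV[C]_3 :=
  \col_i match val i with 0 => x | 1 => y | _ => z end%N.

(* Pauli matrices X, Y, Z *)
Definition pauli (k : 'I_3) : 'M[C]_2 :=
  match val k with
  | 0 => mk2 0 1 1 0
  | 1 => mk2 0 (- Num.imaginary) Num.imaginary 0
  | _ => mk2 1 0 0 (-1)
  end%N.

(* conjugate transpose *)
Definition adj m n (A : 'M[C]_(m, n)) : 'M[C]_(n, m) := (map_mx (fun z => z^*) A)^T.

(* positive semidefinite (over C this includes hermiticity) *)
Definition psd n (A : 'M[C]_n) : Prop :=
  forall v : 'cV[C]_n, 0 <= (adj v *m A *m v) 0 0.

(* density matrix (state) *)
Definition is_state n (A : 'M[C]_n) : Prop := psd A /\ \tr A = 1.

(* the qubit map (M,c) in Bloch representation, extended linearly to all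
   2x2 matrices: X = (tr X * 1 + sum_i tr(sigma_i X) sigma_i)/2 is sent to
   (tr X * 1 + sum_i (M x + tr X * c)_i sigma_i)/2, x_i = tr(sigma_i X). *)
Definition bloch_map (M : 'M[C]_3) (c : 'cV[C]_3) (X : 'M[C]_2) : 'M[C]_2 :=
  let x0 := \tr X in
  let x := \col_i \tr (pauli i *m X) in
  2^-1 *: (x0 *: 1%:M + \sum_(i < 3) ((M *m x) i 0 + x0 * c i 0) *: pauli i).

(* bipartite system C^2 (x) C^d, indexed by the finite type 'I_2 * 'I_d *)
Definition bdim d := #|{: 'I_2 * 'I_d}|.

Definition kron d (A : 'M[C]_2) (B : 'M[C]_d) : 'M[C]_(bdim d) :=
  \matrix_(i, j) (A (enum_val i).1 (enum_val j).1 * B (enum_val i).2 (enum_val j).2).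

Definition block d (rho : 'M[C]_(bdim d)) (a b : 'I_2) : 'M[C]_d :=
  \matrix_(k, l) rho (enum_rank (a, k)) (enum_rank (b, l)).

(* (phi (x) id_d)(rho) *)
Definition tensI d (phi : 'M[C]_2 -> 'M[C]_2) (rho : 'M[C]_(bdim d)) : 'M[C]_(bdim d) :=
  \sum_(a < 2) \sum_(b < 2) kron (phi (delta_mx a b)) (block rho a b).

Definition separable d (rho : 'M[C]_(bdim d)) : Prop :=
  exists m (p : 'I_m -> C) (A : 'I_m -> 'M[C]_2) (B : 'I_m -> 'M[C]_d),
    (forall k, 0 <= p k) /\ (forall k, is_state (A k) /\ is_state (B k)) /\
    rho = \sum_(k < m) p k *: kron (A k) (B k).

Definition completely_positive (phi : 'M[C]_2 -> 'M[C]_2) : Prop :=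
  forall d (rho : 'M[C]_(bdim d)), psd rho -> psd (tensI phi rho).

Definition trace_preserving (phi : 'M[C]_2 -> 'M[C]_2) : Prop :=
  forall X, \tr (phi X) = \tr X.

Definition entanglement_breaking (phi : 'M[C]_2 -> 'M[C]_2) : Prop :=
  forall d (rho : 'M[C]_(bdim d)), is_state rho -> separable (tensI phi rho).

Definition entanglement_saving (phi : 'M[C]_2 -> 'M[C]_2) : Prop :=
  forall n : nat, (1 <= n)%N -> ~ entanglement_breaking (iter n phi).

Definition real_mx m n (A : 'M[C]_(m, n)) : Prop :=
  forall i j, A i j \is Num.real.

Definition SO3 (O : 'M[C]_3) : Prop :=
  real_mx O /\ O^T *m O = 1%:M /\ \det O = 1.

End Qubit.

(* Main.v *)
(** Complete positivity gives Kraus operators K_k. If a pure state is fixed, a half-turn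
    moves it to the north pole; all K_k are then upper triangular, and either the
    coherence sum_k K_k(0,0) K_k(1,1)^* vanishes, so that the map measures and prepares,
    or the Bloch matrix has form (1), the bound on alpha being Cauchy-Schwarz. If no pure
    state is fixed, there is a unique fixed point, interior to the ball, and
    Kadison-Schwarz applied to an eigenoperator A of the dual map with eigenvalue a,
    |a| >= 1, forces A K_k = a K_k A for all k. As A is a 2 x 2 matrix, either a = -1,
    which leads to form (2), or the K_k have a common eigenvector, i.e. a pure fixed state.
    When there is no such a, M^n tends to 0 and phi^n is eventually close enough to a
    constant map with interior value to be of measure-and-prepare type.

    Conversely, if an entanglement-breaking map sends a pure state r to a pure state s,
    its Bloch matrix N satisfies u.(N v) = 0 for u, v orthogonal to s, r respectively.
    Every iterate of a map of form (1) or (2) violates this. *)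
Require Import Defs.
From HB Require Import structures.
From mathcomp Require Import all_boot all_order all_algebra ring.
Import Order.TTheory GRing.Theory Num.Theory.
Local Open Scope ring_scope.

(** The field [C] need not be complete (algebraic numbers are allowed), so compactness, Brouwer's
    theorem and limits of powers are out of reach. The fixed state is found by solving
    [(1 - M) r = c], and the decay of [M ^+ n] is an explicit geometric bound, turned into smallness
    by the archimedean property. The dichotomy between a pure and an interior fixed point is shaped
    by Kadison-Schwarz: its equality case is tested against an invariant state, and only a state of
    full rank detects that each defect operator is zero. The interior fixed point is such a state,
    and it also leaves room around the limit of the iterates, which is what makes them
    measure-and-prepare maps eventually. Entanglement breaking quantifies over all dimensions and
    states, but only two facts about it matter: a measure-and-prepare map has the property, by a
    direct construction, and a map with the property has a measure-and-prepare form, read off from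
    its Choi matrix. *)

Local Notation i0 := (@Ordinal 2 0 isT).
Local Notation i1 := (@Ordinal 2 1 isT).
Local Notation j0 := (@Ordinal 3 0 isT).
Local Notation j1 := (@Ordinal 3 1 isT).
Local Notation j2 := (@Ordinal 3 2 isT).

(** * Bloch coordinates of 2x2 matrices and of qubit maps *)

Section Basics.
Set Implicit Arguments.
Unset Strict Implicit.
Variable C : numClosedFieldType.
Implicit Types (M : 'M[C]_3) (c x y u v r s : 'cV[C]_3) (X Y A B : 'M[C]_2).

Lemma sum2 (V : nmodType) (F : 'I_2 -> V) : \sum_(i < 2) F i = F i0 + F i1.
Proof.
rewrite !big_ord_recl big_ord0 addr0.
by congr (F _ + F _); apply: val_inj.
Qed.

Lemma sum3 (V : nmodType) (F : 'I_3 -> V) : \sum_(i < 3) F i = F j0 + F j1 + F j2.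
Proof.
rewrite !big_ord_recl big_ord0 addr0 addrA.
by congr (F _ + F _ + F _); apply: val_inj.
Qed.

Lemma all_ord2 (P : 'I_2 -> Prop) : P i0 -> P i1 -> forall i, P i.
Proof.
move=> P0 P1 [[|[|//]] lt_i2].
  by have -> : Ordinal lt_i2 = i0 by apply: val_inj.
by have -> : Ordinal lt_i2 = i1 by apply: val_inj.
Qed.

Lemma all_ord3 (P : 'I_3 -> Prop) : P j0 -> P j1 -> P j2 -> forall i, P i.
Proof.
move=> P0 P1 P2 [[|[|[|//]]] lt_i3].
- by have -> : Ordinal lt_i3 = j0 by apply: val_inj.
- by have -> : Ordinal lt_i3 = j1 by apply: val_inj.
by have -> : Ordinal lt_i3 = j2 by apply: val_inj.
Qed.

Lemma mx2_eq X Y : X i0 i0 = Y i0 i0 -> X i0 i1 = Y i0 i1 ->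
  X i1 i0 = Y i1 i0 -> X i1 i1 = Y i1 i1 -> X = Y.
Proof. by move=> *; apply/matrixP; apply: all_ord2; apply: all_ord2. Qed.

Lemma col3_eq x y :
  x j0 0 = y j0 0 -> x j1 0 = y j1 0 -> x j2 0 = y j2 0 -> x = y.
Proof. by move=> *; apply/colP; apply: all_ord3. Qed.

Lemma tr2 X : \tr X = X i0 i0 + X i1 i1.
Proof. by rewrite /mxtrace sum2. Qed.

Lemma mul2E X Y i j : (X *m Y) i j = X i i0 * Y i0 j + X i i1 * Y i1 j.
Proof. by rewrite mxE sum2. Qed.

Lemma mul3E n (X : 'M[C]_(n, 3)) m (Y : 'M[C]_(3, m)) i j :
  (X *m Y) i j = X i j0 * Y j0 j + X i j1 * Y j1 j + X i j2 * Y j2 j.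
Proof. by rewrite mxE sum3. Qed.

Definition bx X : 'cV[C]_3 := \col_i \tr (pauli C i *m X).

(* (t 1 + x.sigma) / 2 *)
Definition pv (t : C) x : 'M[C]_2 :=
  mk2 ((t + x j2 0) / 2) ((x j0 0 - 'i * x j1 0) / 2)
      ((x j0 0 + 'i * x j1 0) / 2) ((t - x j2 0) / 2).

(** Bilinear, without conjugation: it is an inner product on real vectors only, and it is also
    applied to complex eigenvectors. *)
Definition dot x y : C := x j0 0 * y j0 0 + x j1 0 * y j1 0 + x j2 0 * y j2 0.

Lemma bxE X : bx X = col3 (X i0 i1 + X i1 i0) ('i * (X i0 i1 - X i1 i0))
  (X i0 i0 - X i1 i1).
Proof. by apply: col3_eq; rewrite !mxE tr2 !mul2E /pauli !mxE /=; ring. Qed.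

Lemma bloch_mapE M c X : bloch_map M c X = pv (\tr X) (M *m bx X + \tr X *: c).
Proof.
rewrite /bloch_map -/(bx X); set y := M *m bx X.
by apply: mx2_eq; rewrite !mxE summxE sum3 /pauli !mxE /=; ring.
Qed.

Lemma tr_pv t x : \tr (pv t x) = t.
Proof. by rewrite tr2 !mxE /=; field. Qed.

Lemma bx_pv t x : bx (pv t x) = x.
Proof.
rewrite bxE; apply: col3_eq; rewrite !mxE /=.
- by field.
- by field: (sqrCi C).
- by field.
Qed.

Lemma pv_bx X : pv (\tr X) (bx X) = X.
Proof.
by rewrite bxE tr2; apply: mx2_eq; rewrite !mxE /=; field: (sqrCi C).
Qed.

Lemma tr_mul_pv t x t' y : \tr (pv t x *m pv t' y) = (t * t' + dot x y) / 2.
Proof. by rewrite tr2 !mul2E !mxE /= /dot; field: (sqrCi C). Qed.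

Lemma bloch_map_pv M c t x : bloch_map M c (pv t x) = pv t (M *m x + t *: c).
Proof. by rewrite bloch_mapE tr_pv bx_pv. Qed.

Lemma pv_inj t x t' y : pv t x = pv t' y -> t = t' /\ x = y.
Proof.
by move=> e; rewrite -(tr_pv t x) -{2}(bx_pv t x) e tr_pv bx_pv.
Qed.

Lemma pvD t x t' y : pv t x + pv t' y = pv (t + t') (x + y).
Proof. by apply: mx2_eq; rewrite !mxE /=; ring. Qed.

Lemma pvZ a t x : a *: pv t x = pv (a * t) (a *: x).
Proof. by apply: mx2_eq; rewrite !mxE /=; ring. Qed.

Lemma tr_bloch M c X : \tr (bloch_map M c X) = \tr X.
Proof. by rewrite bloch_mapE tr_pv. Qed.

Lemma mulmx_ext m n (P Q : 'M[C]_(m, n)) :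
  (forall x : 'cV[C]_n, P *m x = Q *m x) -> P = Q.
Proof.
move=> h; apply/matrixP => i j.
by have := h (delta_mx j 0); rewrite -!colE => /colP /(_ i); rewrite !mxE.
Qed.

Lemma bloch_ext M c M' c' :
  (forall X, bloch_map M c X = bloch_map M' c' X) -> M = M' /\ c = c'.
Proof.
move=> h; have hv t x : M *m x + t *: c = M' *m x + t *: c'.
  by have := h (pv t x); rewrite !bloch_map_pv => /pv_inj [].
have ec : c = c' by have := hv 1 0; rewrite !mulmx0 !scale1r !add0r.
split=> //; apply: mulmx_ext => x.
by have := hv 0 x; rewrite !scale0r !addr0.
Qed.

(** The sum of the [M ^+ k *m c] for [k < n], that is, the translation part of the [n]-th
    iterate. *)
Fixpoint iter_shift M c n : 'cV[C]_3 :=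
  if n is n'.+1 then M *m iter_shift M c n' + c else 0.

Lemma iter_bloch M c n X :
  iter n (bloch_map M c) X = bloch_map (M ^+ n) (iter_shift M c n) X.
Proof.
elim: n => [|n IH] /=; first by rewrite bloch_mapE mul1mx scaler0 addr0 pv_bx.
rewrite IH !bloch_mapE tr_pv bx_pv; congr pv.
by rewrite exprS mulmxDr -scalemxAr mulmxA scalerDr addrA.
Qed.

Lemma bloch_linear M c a X Y :
  bloch_map M c (a *: X + Y) = a *: bloch_map M c X + bloch_map M c Y.
Proof.
rewrite !bloch_mapE pvZ pvD; congr pv.
  by rewrite linearP.
rewrite (_ : bx _ = a *: bx X + bx Y).
  by rewrite mulmxDr -scalemxAr linearP scalerDl scalerDr scalerA addrACA.
by rewrite !bxE; apply: col3_eq; rewrite !mxE /=; ring.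
Qed.

Lemma quadE n (A : 'M[C]_n) (v : 'cV[C]_n) :
  (adj v *m A *m v) 0 0 = \sum_i \sum_j (v i 0)^* * A i j * v j 0.
Proof.
rewrite mxE exchange_big /=; apply: eq_bigr => j _.
by rewrite mxE mulr_suml; apply: eq_bigr => i _; rewrite !mxE.
Qed.

Lemma quad2E A (v : 'cV[C]_2) : (adj v *m A *m v) 0 0 =
  (v i0 0)^* * A i0 i0 * v i0 0 + (v i0 0)^* * A i0 i1 * v i1 0 +
  ((v i1 0)^* * A i1 i0 * v i0 0 + (v i1 0)^* * A i1 i1 * v i1 0).
Proof. by rewrite quadE !sum2. Qed.

End Basics.

(** * Positive semidefinite matrices and the Bloch ball *)

Section Positivity.
Set Implicit Arguments.
Unset Strict Implicit.
Variable C : numClosedFieldType.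
Implicit Types (M : 'M[C]_3) (c x y u v r s : 'cV[C]_3) (X Y A B : 'M[C]_2).

Lemma eq_by_sub (V : zmodType) (a b a' b' : V) : a - b = a' - b' -> a' = b' -> a = b.
Proof. by move=> e /eqP; rewrite -subr_eq0 -e subr_eq0 => /eqP. Qed.

Lemma ctrmxD m n (A B : 'M[C]_(m, n)) : adj (A + B) = adj A + adj B.
Proof. by apply/matrixP => i j; rewrite !mxE rmorphD. Qed.

Lemma ctrmxZ m n a (A : 'M[C]_(m, n)) : adj (a *: A) = a^* *: adj A.
Proof. by apply/matrixP => i j; rewrite !mxE rmorphM. Qed.

Lemma ctrmxK m n (A : 'M[C]_(m, n)) : adj (adj A) = A.
Proof. by apply/matrixP => i j; rewrite !mxE conjCK. Qed.

Lemma ctrmxM m n p (A : 'M[C]_(m, n)) (B : 'M[C]_(n, p)) :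
  adj (A *m B) = adj B *m adj A.
Proof. by rewrite /adj map_mxM trmx_mul. Qed.

Lemma ctrmx_sum m n p (F : 'I_p -> 'M[C]_(m, n)) :
  adj (\sum_k F k) = \sum_k adj (F k).
Proof.
apply: big_morph; first exact: ctrmxD.
by apply/matrixP => i j; rewrite !mxE conjC0.
Qed.

Lemma norm_adj n (w : 'cV[C]_n) : (adj w *m w) 0 0 = \sum_i `|w i 0| ^+ 2.
Proof.
by rewrite mxE; apply: eq_bigr => i _; rewrite !mxE normCK mulrC.
Qed.

Lemma psd_gram m n (V : 'M[C]_(n, m)) : psd (V *m adj V).
Proof.
move=> w; rewrite mulmxA -mulmxA -[V in adj w *m V]ctrmxK -ctrmxM norm_adj.
by apply: sumr_ge0 => i _; rewrite exprn_ge0.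
Qed.

Lemma psd_congr m n (A : 'M[C]_n) (W : 'M[C]_(n, m)) :
  psd A -> psd (adj W *m A *m W).
Proof. by move=> psdA w; have := psdA (W *m w); rewrite ctrmxM !mulmxA. Qed.

Lemma psdZ n a (A : 'M[C]_n) : 0 <= a -> psd A -> psd (a *: A).
Proof. by move=> a0 pA w; rewrite -scalemxAr -scalemxAl mxE mulr_ge0. Qed.

Lemma adj_delta n (i : 'I_n) : adj (delta_mx i 0 : 'cV[C]_n) = delta_mx 0 i.
Proof. by apply/matrixP => a b; rewrite !mxE conjC_nat andbC. Qed.

Lemma psd_diag n (A : 'M[C]_n) i : psd A -> 0 <= A i i.
Proof. by move/(_ (delta_mx i 0)); rewrite adj_delta -rowE -colE !mxE. Qed.

(** Being nonnegative includes being real. Polarization: reality of the form at [e_i + t e_j] for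
    [t = 1] and [t = 'i] gives two linear relations that determine [A j i]. *)
Lemma psd_herm n (A : 'M[C]_n) : psd A -> adj A = A.
Proof.
move=> pA; apply/matrixP => j i; rewrite !mxE.
have q t : 0 <= A i i + t * A i j + (t^* * A j i + t^* * t * A j j).
  have := pA (delta_mx i 0 + t *: delta_mx j 0).
  rewrite ctrmxD ctrmxZ !adj_delta mulmxDl !mulmxDr !mulmxDl -!scalemxAr -!scalemxAl.
  rewrite -!rowE -!colE !mxE => h; apply: le_trans h _.
  by rewrite le_eqVlt; apply/orP; left; apply/eqP; ring.
have ci : 'i^* = - 'i :> C by exact: conjCi.
have r1 := CrealP (ger0_real (q 1)); have r2 := CrealP (ger0_real (q 'i)).
have ri := CrealP (ger0_real (psd_diag i pA)).
have rj := CrealP (ger0_real (psd_diag j pA)).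
move: r1 r2; rewrite !rmorphD !rmorphM /= ri rj !conjCK rmorph1 ci => r1 r2.
have e1 : (A i j)^* + (A j i)^* = A i j + A j i by apply: (eq_by_sub _ r1); ring.
have e2 : 'i * ((A j i)^* - (A i j)^*) = 'i * (A i j - A j i) by apply: (eq_by_sub _ r2); ring.
move/(mulfI (neq0Ci C)) in e2.
have : 2 * (A i j)^* = 2 * A j i.
  rewrite (_ : 2 * (A i j)^* = (A i j)^* + (A j i)^* - ((A j i)^* - (A i j)^*)); last by ring.
  by rewrite e1 e2; ring.
by apply: mulfI; rewrite pnatr_eq0.
Qed.

Lemma psd2P A : psd A <->
  [/\ 0 <= A i0 i0, 0 <= A i1 i1, A i1 i0 = (A i0 i1)^* &
      A i0 i1 * (A i0 i1)^* <= A i0 i0 * A i1 i1].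
Proof.
set a := A i0 i0; set b := A i0 i1; set d := A i1 i1; split=> [pA|].
  have a0 : 0 <= a by apply: psd_diag.
  have d0 : 0 <= d by apply: psd_diag.
  have h : A i1 i0 = b^* by rewrite -(psd_herm pA) !mxE.
  have ra := CrealP (ger0_real a0); have rd := CrealP (ger0_real d0).
  split=> //.
  have q (x y : C) : 0 <= x^* * a * x + x^* * b * y + (y^* * b^* * x + y^* * d * y).
    have := pA (\col_i if i == i0 then x else y).
    by rewrite quad2E !mxE /= h -/a -/b -/d.
  rewrite -subr_ge0.
  have [a_gt0|a_le0] := boolP (0 < a).
    rewrite -(pmulr_rge0 _ a_gt0); have := q b (- a).
    by rewrite rmorphN /= ra; congr (0 <= _); ring.
  have [d_gt0|d_le0] := boolP (0 < d).
    rewrite -(pmulr_rge0 _ d_gt0); have := q d (- b^*).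
    by rewrite rmorphN /= rd conjCK; congr (0 <= _); ring.
  have ea : a = 0 by apply/eqP; move: a_le0; rewrite lt_def a0 andbT negbK.
  have ed : d = 0 by apply/eqP; move: d_le0; rewrite lt_def d0 andbT negbK.
  have := q b (- 1); rewrite rmorphN rmorph1 /= ea ed => h2.
  rewrite -(pmulr_rge0 _ (ltr0Sn C 1)); apply: le_trans h2 _.
  by rewrite le_eqVlt; apply/orP; left; apply/eqP; ring.
move=> [a0 d0 h le_b]; move=> w; rewrite quad2E -/a -/b -/d h.
set x := w i0 0; set y := w i1 0.
have ra := CrealP (ger0_real a0).
have [a_gt0|a_le0] := boolP (0 < a).
  rewrite -(pmulr_rge0 _ a_gt0).
  rewrite (_ : a * _ = (a * x + b * y) * (a * x + b * y)^*
                       + (a * d - b * b^*) * (y * y^*)).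
    by rewrite addr_ge0 ?mul_conjC_ge0 // mulr_ge0 ?mul_conjC_ge0 // subr_ge0.
  by rewrite rmorphD !rmorphM /= ra; ring.
have ea : a = 0 by apply/eqP; move: a_le0; rewrite lt_def a0 andbT negbK.
have eb : b = 0.
  apply/eqP; rewrite -mul_conjC_eq0 eq_le mul_conjC_ge0 andbT.
  by move: le_b; rewrite ea mul0r.
rewrite ea eb rmorph0 !(mulr0, mul0r) !add0r mulrAC mulr_ge0 //.
by rewrite mulrC mul_conjC_ge0.
Qed.

Lemma psd_trmx A : psd A -> psd A^T.
Proof.
move=> /psd2P [a0 d0 h le_b]; apply/psd2P; rewrite !mxE; split=> //.
  by rewrite h conjCK.
by rewrite h conjCK mulrC.
Qed.

(** The determinant of [pv t x] is [(t ^+ 2 - dot x x) / 4]. *)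
Lemma psd_pv t x : real_mx x -> 0 <= t -> dot x x <= t ^+ 2 -> psd (pv t x).
Proof.
move=> rx t0 le_x.
have h2 : (0 : C) < 2^-1 by rewrite invr_gt0 ltr0Sn.
have h2' := CrealP (gtr0_real h2).
have le_xj : x j2 0 ^+ 2 <= t ^+ 2.
  apply: le_trans le_x; rewrite /dot addrC lerDl.
  by rewrite addr_ge0 // -expr2 real_exprn_even_ge0 ?rx.
have rt : t \is Num.real by apply: ger0_real.
have le_j : `|x j2 0| <= t.
  by rewrite -(ger0_norm t0) -ler_sqr ?nnegrE // !real_normK ?rx.
have [x0 x1 x2] : [/\ (x j0 0)^* = x j0 0, (x j1 0)^* = x j1 0
    & (x j2 0)^* = x j2 0] by split; apply/CrealP/rx.
apply/psd2P; rewrite !mxE /=; move: le_j; rewrite real_ler_norml ?rx //.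
case/andP => h1 h3; split.
- by rewrite mulr_ge0 ?(ltW h2) // -lerBlDl sub0r.
- by rewrite mulr_ge0 ?(ltW h2) // subr_ge0.
- rewrite rmorphM rmorphB rmorphM /= x0 x1 conjCi h2'; ring.
rewrite rmorphM rmorphB rmorphM /= x0 x1 conjCi h2' -subr_ge0.
rewrite (_ : _ - _ = 2^-1 * 2^-1 * (t ^+ 2 - dot x x)).
  by rewrite mulr_ge0 ?subr_ge0 // mulr_ge0 // ltW.
by rewrite /dot; ring: (sqrCi C).
Qed.

Lemma psd_bloch A : psd A ->
  [/\ 0 <= \tr A, real_mx (bx A) & dot (bx A) (bx A) <= \tr A ^+ 2].
Proof.
move=> /psd2P; rewrite bxE /dot tr2 !mxE /=.
set a := A i0 i0; set b := A i0 i1; set d := A i1 i1 => -[a0 d0 -> le_b].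
have ra := CrealP (ger0_real a0); have rd := CrealP (ger0_real d0).
split; first exact: addr_ge0.
  move=> i j; rewrite (ord1 j) {j}; move: i; apply: all_ord3; rewrite !mxE /=.
  - by apply/CrealP; rewrite rmorphD /= conjCK addrC.
  - by apply/CrealP; rewrite rmorphM rmorphB /= conjCK conjCi; ring.
  - by rewrite rpredB // ger0_real.
rewrite -subr_ge0.
rewrite (_ : _ - _ = 4 * (a * d - b * b^*)).
  by rewrite mulr_ge0 ?subr_ge0.
by ring: (sqrCi C).
Qed.

Lemma state_bloch A : is_state A ->
  [/\ A = pv 1 (bx A), real_mx (bx A) & dot (bx A) (bx A) <= 1].
Proof.
case=> /psd_bloch [_ rA le_A] trA; split=> //; last by rewrite trA expr1n in le_A.
by rewrite -trA pv_bx.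
Qed.

Lemma state_pv x : real_mx x -> dot x x <= 1 -> is_state (pv 1 x).
Proof.
by move=> rx le_x; split; [apply: psd_pv; rewrite ?expr1n | apply: tr_pv].
Qed.

(* The spectral theorem gives A = P^* D P with D >= 0; take V = P^* D^{1/2}. *)
Lemma psd_factor n (A : 'M[C]_n) : psd A -> exists V : 'M[C]_n, A = V *m adj V.
Proof.
move=> pA.
have hA : A \is normalmx.
  have e : map_mx Num.conj A^T = A by rewrite -[RHS](psd_herm pA); apply/matrixP => i j; rewrite !mxE.
  by apply/normalmxP; rewrite e.
have eA := orthomx_spectralP hA.
set P := spectralmx A in eA; set D := spectral_diag A in eA.
have uP : P \is unitarymx by apply: spectral_unitarymx.
rewrite (invmx_unitary uP) in eA.
have eQ : map_mx Num.conj P^T = adj P by apply/matrixP => i j; rewrite !mxE.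
rewrite eQ in eA.
have PP : P *m adj P = 1%:M by rewrite -eQ; apply/unitarymxP.
have eD : diag_mx D = P *m A *m adj P.
  by rewrite eA !mulmxA PP mul1mx -mulmxA PP mulmx1.
have D0 i : 0 <= D 0 i.
  have /(_ n (adj P)) := @psd_congr _ _ _ _ pA; rewrite ctrmxK -eD => /psd_diag.
  by move/(_ i); rewrite mxE eqxx mulr1n.
exists (adj P *m diag_mx (\row_i sqrtC (D 0 i))).
rewrite ctrmxM ctrmxK {1}eA mulmxA -(mulmxA (adj P)); congr (_ *m _ *m _).
apply/matrixP => i j; rewrite mul_diag_mx !mxE.
have rs k : (sqrtC (D 0 k))^* = sqrtC (D 0 k).
  by apply/CrealP/ger0_real; rewrite sqrtC_ge0.
rewrite (eq_sym j i); case: eqP => [->|_]; last by rewrite !mulr0n conjC0 mulr0.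
by rewrite !mulr1n rs -expr2 sqrtCK.
Qed.

Lemma psd_tr_ge0 n (A : 'M[C]_n) : psd A -> 0 <= \tr A.
Proof. by move=> pA; apply: sumr_ge0 => i _; apply: psd_diag. Qed.

Lemma tr_gram_eq0 m n (V : 'M[C]_(n, m)) : \tr (V *m adj V) = 0 -> V = 0.
Proof.
have -> : \tr (V *m adj V) = \sum_i \sum_j `|V i j| ^+ 2.
  apply: eq_bigr => i _; rewrite mxE; apply: eq_bigr => j _.
  by rewrite !mxE normCK.
move/eqP; rewrite psumr_eq0 => [/allP h|i _]; last first.
  by apply: sumr_ge0 => j _; rewrite exprn_ge0.
apply/matrixP => i j; rewrite mxE; have /= := h i (mem_index_enum i).
rewrite psumr_eq0 => [/allP /(_ j (mem_index_enum j)) /=|k _].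
  by rewrite sqrf_eq0 normr_eq0 => /eqP.
by rewrite exprn_ge0.
Qed.

Lemma psd_tr_eq0 n (A : 'M[C]_n) : psd A -> \tr A = 0 -> A = 0.
Proof. by move=> /psd_factor [V ->] /tr_gram_eq0 ->; rewrite mul0mx. Qed.

End Positivity.

(** * Entanglement-breaking maps and the measure-and-prepare form *)

Section Breaking.
Set Implicit Arguments.
Unset Strict Implicit.
Variable C : numClosedFieldType.
Implicit Types (M : 'M[C]_3) (c x y u v r s : 'cV[C]_3) (X Y A B : 'M[C]_2).

(** The Holevo form with rank-one effects [f k *m adj (f k)]; rank one lets positivity be tested on
    product vectors. *)
Definition measure_prepare (phi : 'M[C]_2 -> 'M[C]_2) : Prop :=
  exists m (f : 'I_m -> 'cV[C]_2) (R : 'I_m -> 'M[C]_2),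
    (forall k, is_state (R k)) /\
    forall X, phi X = \sum_(k < m) ((adj (f k) *m X *m f k) 0 0) *: R k.

Lemma eb_ext phi psi : phi =1 psi ->
  entanglement_breaking phi -> @entanglement_breaking C psi.
Proof.
move=> e h d rho /h; rewrite /tensI.
by under eq_bigr => a _ do under eq_bigr => b _ do rewrite e.
Qed.

Lemma sum_bdim (V : nmodType) d (F : 'I_2 * 'I_d -> V) :
  \sum_(i < bdim d) F (enum_val i) = \sum_a \sum_k F (a, k).
Proof.
rewrite pair_bigA /= -(big_enum_val (A := {: 'I_2 * 'I_d}) F).
by apply: eq_bigr => -[].
Qed.

Lemma quad_delta (f : 'cV[C]_2) a b :
  (adj f *m delta_mx a b *m f) 0 0 = (f a 0)^* * f b 0.
Proof.
rewrite quad2E; move: a b; apply: all_ord2; apply: all_ord2; rewrite !mxE /=; ring.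
Qed.

(** Measuring [f k] on the first factor leaves the operator [B k] on the second one. It is positive
    because its form at [v] is the form of [rho] at the product vector of [f k] and [v]; its trace
    is the weight. *)
Lemma measure_prepare_eb phi :
  measure_prepare phi -> entanglement_breaking phi.
Proof.
case=> m [f [R [sR ephi]]] d rho [psd_rho tr_rho].
pose B k : 'M[C]_d :=
  \sum_a \sum_b ((f k a 0)^* * f k b 0) *: block rho a b.
have eT : tensI phi rho = \sum_k kron (R k) (B k).
  apply/matrixP => i j; rewrite /tensI !summxE.
  transitivity (\sum_k \sum_a \sum_b (f k a 0)^* * f k b 0 *
      (R k (enum_val i).1 (enum_val j).1
       * block rho a b (enum_val i).2 (enum_val j).2)).
    rewrite exchange_big /=; apply: eq_bigr => a _.
    rewrite exchange_big /= !summxE; apply: eq_bigr => b _.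
    rewrite mxE ephi summxE mulr_suml; apply: eq_bigr => k _.
    by rewrite mxE quad_delta mulrA.
  apply: eq_bigr => k _; rewrite !mxE summxE mulr_sumr; apply: eq_bigr => a _.
  rewrite summxE mulr_sumr; apply: eq_bigr => b _.
  by rewrite !mxE; ring.
have psdB k : psd (B k).
  move=> v; pose w : 'cV[C]_(bdim d) :=
    \col_i (f k (enum_val i).1 0 * v (enum_val i).2 0).
  suff -> : (adj v *m B k *m v) 0 0 = (adj w *m rho *m w) 0 0 by apply: psd_rho.
  rewrite !quadE.
  pose G (p q : 'I_2 * 'I_d) := (f k p.1 0 * v p.2 0)^* *
    rho (enum_rank p) (enum_rank q) * (f k q.1 0 * v q.2 0).
  transitivity (\sum_a \sum_l \sum_b \sum_n G (a, l) (b, n)); last first.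
    rewrite -(sum_bdim (fun p => \sum_b \sum_n G p (b, n))).
    apply: eq_bigr => i _; rewrite -(sum_bdim (G (enum_val i))).
    by apply: eq_bigr => j _; rewrite /G !enum_valK !mxE.
  rewrite [RHS]exchange_big /=; apply: eq_bigr => l _.
  under eq_bigr => n _ do rewrite !summxE mulr_sumr mulr_suml.
  rewrite exchange_big /=; apply: eq_bigr => a _.
  under eq_bigr => n _ do rewrite !summxE mulr_sumr mulr_suml.
  rewrite exchange_big /=; apply: eq_bigr => b _.
  by apply: eq_bigr => n _; rewrite /G !mxE /= rmorphM; ring.
(* Trace one excludes [d = 0], so some state [e0] exists; it fills the terms whose [B k] has trace
   zero and cannot be normalised. *)
have d0 : (0 < d)%N.
  case: (d) rho tr_rho {psd_rho B eT psdB} => // rho.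
  rewrite /mxtrace big1 => [/esym/eqP|i _]; first by rewrite oner_eq0.
  by case: (enum_val i) => _ [].
pose e0 : 'cV[C]_d := delta_mx (Ordinal d0) 0.
have state0 : is_state (e0 *m adj e0).
  split; first exact: psd_gram.
  rewrite adj_delta mul_delta_mx /mxtrace (bigD1 (Ordinal d0)) //= mxE !eqxx.
  by rewrite big1 ?addr0 // => i ni; rewrite mxE (negPf ni).
exists m, (fun k => \tr (B k)), R.
exists (fun k => if \tr (B k) == 0 then e0 *m adj e0 else (\tr (B k))^-1 *: B k).
split; first by move=> k; apply: psd_tr_ge0.
split.
  move=> k; split=> //; case: eqP => // /eqP n0; split.
    by apply: psdZ => //; rewrite invr_ge0 psd_tr_ge0.
  by rewrite mxtraceZ mulVf.
rewrite eT; apply: eq_bigr => k _; apply/matrixP => i j; rewrite !mxE.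
case: (altP eqP) => [t0|n0].
  by rewrite t0 mul0r (psd_tr_eq0 (psdB k) t0) mxE mulr0.
by rewrite !mxE mulrCA; congr (_ * _); rewrite mulrA mulfV ?mul1r.
Qed.

Lemma bloch_decomp M c X : bloch_map M c X =
  \sum_a \sum_b X a b *: bloch_map M c (delta_mx a b).
Proof.
have e0 : bloch_map M c 0 = 0.
  have := bloch_linear M c (-1) 0 0; rewrite scaleN1r addNr => ->.
  by rewrite scaleN1r addNr.
rewrite !sum2 -addrA {1}(_ : X = X i0 i0 *: delta_mx i0 i0 + (X i0 i1 *: delta_mx i0 i1
   + (X i1 i0 *: delta_mx i1 i0 + (X i1 i1 *: delta_mx i1 i1 + 0)))).
  by rewrite !bloch_linear e0 addr0.
by apply: mx2_eq; rewrite !mxE /=; ring.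
Qed.

(** Not normalised: its squared norm is 2, so the state built from it carries the factor [2^-1]. *)
Definition max_ent : 'cV[C]_(bdim 2) :=
  \col_i ((enum_val i).1 == (enum_val i).2)%:R.

(** This is the Choi matrix of [phi]. The scalar [t] covers both the state ([t = 2^-1]) and the bare
    matrix ([t = 1]). *)
Lemma tensI_max_ent (phi : 'M[C]_2 -> 'M[C]_2) t (i j a b : 'I_2) :
  tensI phi (t *: (max_ent *m adj max_ent)) (enum_rank (i, a)) (enum_rank (j, b))
  = t * phi (delta_mx a b) i j.
Proof.
rewrite /tensI !summxE (bigD1 a) //= summxE (bigD1 b) //= [X in _ + X]big1; last first.
  move=> a' na; rewrite summxE big1 // => b' _.
  by rewrite !mxE big_ord1 !mxE !enum_rankK /= (negPf na) conjC_nat mul0r !mulr0.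
rewrite big1; last first.
  move=> b' nb.
  by rewrite !mxE big_ord1 !mxE !enum_rankK /= (negPf nb) conjC_nat !mulr0.
rewrite !addr0 !mxE !big_ord1 !mxE !enum_rankK /= !eqxx conjC_nat !mulr1.
by rewrite mulrC.
Qed.

(* Evaluate the definition on the maximally entangled state of two qubits. *)
Lemma eb_delta (phi : 'M[C]_2 -> 'M[C]_2) : entanglement_breaking phi ->
  exists m (p : 'I_m -> C) (A B : 'I_m -> 'M[C]_2),
    [/\ forall k, 0 <= p k, forall k, is_state (A k), forall k, is_state (B k) &
    forall a b, phi (delta_mx a b) = \sum_k (2 * p k * B k a b) *: A k].
Proof.
pose w := 2^-1 *: (max_ent *m adj max_ent).
have hw i j : w i j = 2^-1 * (((enum_val i).1 == (enum_val i).2)%:R *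
    ((enum_val j).1 == (enum_val j).2)%:R).
  by rewrite !mxE big_ord1 !mxE conjC_nat.
have sw : is_state w.
  split; first by apply: psdZ; [rewrite invr_ge0 ler0n | apply: psd_gram].
  rewrite /mxtrace; under eq_bigr => i _ do rewrite hw.
  rewrite (sum_bdim (fun p => 2^-1 * ((p.1 == p.2)%:R * (p.1 == p.2)%:R))) /=.
  by rewrite sum2 !sum2 /=; field.
case/(_ 2 w sw) => m [p [A [B [p0 [sAB eT]]]]]; exists m, p, A, B.
have sA k : is_state (A k) by case: (sAB k).
have sB k : is_state (B k) by case: (sAB k).
split=> // a b.
apply/matrixP => i j; move/matrixP: eT => /(_ (enum_rank (i, a)) (enum_rank (j, b))).
rewrite tensI_max_ent => e.
have -> : phi (delta_mx a b) i j = 2 * (2^-1 * phi (delta_mx a b) i j) by field.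
rewrite e !summxE mulr_sumr; apply: eq_bigr => k _.
by rewrite !mxE !enum_rankK /=; ring.
Qed.

(** Expanding [X] in matrix units pairs [X a b] with [B k a b], which is a trace only after
    transposing [B k]. The factor 2 undoes the normalisation of the entangled state. *)
Lemma eb_measure_prepare M c : entanglement_breaking (bloch_map M c) ->
  exists m (p : 'I_m -> C) (A B : 'I_m -> 'M[C]_2),
    [/\ forall k, 0 <= p k, forall k, is_state (A k), forall k, is_state (B k) &
    forall X, bloch_map M c X = \sum_k (2 * p k * \tr ((B k)^T *m X)) *: A k].
Proof.
case/eb_delta => m [p [A [B [p0 sA sB eD]]]]; exists m, p, A, B; split=> //.
move=> X; rewrite bloch_decomp.
under eq_bigr => a _ do under eq_bigr => b _ do rewrite eD scaler_sumr.
under eq_bigr => a _ do rewrite exchange_big /=.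
rewrite exchange_big /=; apply: eq_bigr => k _.
rewrite !sum2 tr2 !mul2E !mxE !scalerA -!scalerDl; congr (_ *: _); ring.
Qed.

Lemma dot_ge0 x : real_mx x -> 0 <= dot x x.
Proof.
by move=> rx; rewrite /dot -!expr2 !addr_ge0 // real_exprn_even_ge0 ?rx.
Qed.

Lemma dot_eq0 x : real_mx x -> dot x x = 0 -> x = 0.
Proof.
have sq (t : C) : t \is Num.real -> 0 <= t ^+ 2.
  by move=> rt; rewrite real_exprn_even_ge0.
move=> rx /eqP; rewrite /dot -!expr2 paddr_eq0 ?addr_ge0 ?sq ?rx //.
rewrite paddr_eq0 ?sq ?rx // !sqrf_eq0.
by case/andP => /andP [/eqP h0 /eqP h1] /eqP h2; apply: col3_eq; rewrite mxE.
Qed.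

Lemma dotC x y : dot x y = dot y x.
Proof. by rewrite /dot; ring. Qed.

Lemma dotDl x y u : dot (x + y) u = dot x u + dot y u.
Proof. by rewrite /dot !mxE; ring. Qed.

Lemma dotDr x y u : dot u (x + y) = dot u x + dot u y.
Proof. by rewrite /dot !mxE; ring. Qed.

Lemma dotZl a x y : dot (a *: x) y = a * dot x y.
Proof. by rewrite /dot !mxE; ring. Qed.

Lemma dotZr a x y : dot x (a *: y) = a * dot x y.
Proof. by rewrite /dot !mxE; ring. Qed.

Lemma dotNl x y : dot (- x) y = - dot x y.
Proof. by rewrite /dot !mxE; ring. Qed.

Lemma dotNr x y : dot x (- y) = - dot x y.
Proof. by rewrite /dot !mxE; ring. Qed.

Lemma dot0r x : dot x 0 = 0.
Proof. by rewrite /dot !mxE; ring. Qed.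

Lemma dot_sumr u m (F : 'I_m -> 'cV[C]_3) :
  dot u (\sum_k F k) = \sum_k dot u (F k).
Proof.
rewrite /dot !summxE !mulr_sumr -!big_split /=.
by apply: eq_bigr => k _.
Qed.

Lemma real_mxD m n (P Q : 'M[C]_(m, n)) : real_mx P -> real_mx Q -> real_mx (P + Q).
Proof. by move=> hP hQ i j; rewrite mxE rpredD ?hP ?hQ. Qed.

Lemma real_mxN m n (P : 'M[C]_(m, n)) : real_mx P -> real_mx (- P).
Proof. by move=> hP i j; rewrite mxE rpredN hP. Qed.

Lemma real_mxZ m n a (P : 'M[C]_(m, n)) :
  a \is Num.real -> real_mx P -> real_mx (a *: P).
Proof. by move=> ra hP i j; rewrite mxE rpredM ?hP. Qed.

Lemma real_mxM m n p (P : 'M[C]_(m, n)) (Q : 'M[C]_(n, p)) :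
  real_mx P -> real_mx Q -> real_mx (P *m Q).
Proof. by move=> hP hQ i j; rewrite mxE rpred_sum // => k _; rewrite rpredM ?hP ?hQ. Qed.

Lemma real_dot x y : real_mx x -> real_mx y -> dot x y \is Num.real.
Proof. by move=> rx ry; rewrite /dot !rpredD ?rpredM ?rx ?ry. Qed.

(** Both parts follow from [|x - s|^2 <= 2 (1 - s.x)]: the left side is nonnegative, and vanishes
    only for [x = s]. *)
Lemma ball_dot_le1 x s : real_mx x -> real_mx s -> dot x x <= 1 -> dot s s = 1 ->
  dot s x <= 1 /\ (dot s x = 1 -> x = s).
Proof.
move=> rx rs x1 s1; have rd := real_mxD rx (real_mxN rs).
have h := dot_ge0 rd.
have e : dot (x - s) (x - s) = dot x x - 2 * dot s x + dot s s.
  by rewrite /dot !mxE; ring.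
have h2 : dot (x - s) (x - s) <= 2 * (1 - dot s x).
  by rewrite e s1 -subr_ge0 (_ : _ - _ = 1 - dot x x) ?subr_ge0 //; ring.
split; first by rewrite -subr_ge0 -(pmulr_rge0 _ (ltr0Sn C 1)); apply: le_trans h2.
move=> d1; apply/eqP; rewrite -subr_eq0; apply/eqP/dot_eq0 => //.
by apply/eqP; rewrite eq_le h andbT; rewrite d1 subrr mulr0 in h2.
Qed.

(* With M = sum p_k a_k b_k^T, the equality case of the ball inequality at the pure
   output s forces a_k = s or b_k = - r for every k with p_k <> 0. *)
Lemma eb_pure_output M c r s u v :
  entanglement_breaking (bloch_map M c) ->
  real_mx r -> real_mx s -> dot r r = 1 -> dot s s = 1 -> M *m r + c = s ->
  dot u s = 0 -> dot v r = 0 -> dot u (M *m v) = 0.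
Proof.
case/eb_measure_prepare => m [p [A [B [p0 sA sB eM]]]] rr rs r1 s1 es us vr.
pose a k := bx (A k); pose b k := bx ((B k)^T).
have sB' k : is_state ((B k)^T).
  by case: (sB k) => pB tB; split; [apply: psd_trmx | rewrite mxtrace_tr].
have ep t x : bloch_map M c (pv t x) = \sum_k (p k * (t + dot (b k) x)) *: A k.
  rewrite eM; apply: eq_bigr => k _; congr (_ *: _).
  have {1}-> : (B k)^T = pv 1 (b k) by case: (state_bloch (sB' k)).
  by rewrite tr_mul_pv mul1r; field.
have et t x : t = \sum_k p k * (t + dot (b k) x).
  rewrite -{1}(tr_pv t x) -(tr_bloch M c) ep linear_sum /=.
  by apply: eq_bigr => k _; rewrite linearZ /= (sA k).2 mulr1.
have eb t x : M *m x + t *: c = \sum_k (p k * (t + dot (b k) x)) *: a k.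
  have [_ <-] : t = t /\ bx (bloch_map M c (pv t x)) = M *m x + t *: c.
    by rewrite bloch_map_pv bx_pv.
  rewrite ep; apply: col3_eq; rewrite bxE !mxE /= ?summxE ?mulr_sumr;
    rewrite -?big_split -?sumrB ?mulr_sumr /=; apply: eq_bigr => k _;
    by rewrite /a bxE !mxE /=; ring.
have Nr1 : dot (- r) (- r) = 1 by rewrite dotNl dotNr opprK.
have hk k : p k = 0 \/ b k = - r \/ a k = s.
  (* At [r] the weights [p i * (1 + b_i.r)] sum to 1 and average the [a_i] to [s]. Pairing with [s],
     these nonnegative terms therefore sum to [1 - s.s = 0]: a pure state is an extreme point. *)
  have term_ge0 i : 0 <= p i * (1 + dot (b i) r) * (1 - dot s (a i)).
    case: (state_bloch (sB' i)) => _ rb lb; case: (state_bloch (sA i)) => _ ra la.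
    rewrite mulr_ge0 //; last by rewrite subr_ge0; case: (ball_dot_le1 ra rs la s1).
    rewrite mulr_ge0 // -subr_ge0.
    have [+ _] := ball_dot_le1 rb (real_mxN rr) lb Nr1.
    by rewrite dotNl dotC subr0 -subr_ge0 opprK.
  have : \sum_i p i * (1 + dot (b i) r) * (1 - dot s (a i)) == 0.
    under eq_bigr => i _ do rewrite mulrBr mulr1.
    rewrite sumrB -(et 1 r) subr_eq0; apply/eqP.
    transitivity (dot s (M *m r + 1 *: c)); first by rewrite scale1r es s1.
    by rewrite eb dot_sumr; apply: eq_bigr => i _; rewrite dotZr.
  rewrite psumr_eq0 // => /allP /(_ k (mem_index_enum k)) /=.
  case: (state_bloch (sB' k)) => _ rb lb; case: (state_bloch (sA k)) => _ ra la.
  rewrite !mulf_eq0 -orbA => /or3P [/eqP|/eqP h|/eqP h]; first by left.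
- right; left; have [_] := ball_dot_le1 rb (real_mxN rr) lb Nr1; apply.
    by rewrite dotNl dotC; apply/eqP; rewrite eqr_oppLR -addr_eq0 addrC h.
- right; right; case: (ball_dot_le1 ra rs la s1) => _; apply.
  by apply/esym/eqP; rewrite -subr_eq0 h.
have := eb 0 v; rewrite scale0r addr0 => ->; rewrite dot_sumr big1 // => k _.
rewrite dotZr add0r; case: (hk k) => [->|[->|->]].
- by rewrite !mul0r.
- by rewrite dotNl [dot r v]dotC vr oppr0 mulr0 mul0r.
by rewrite us mulr0.
Qed.

End Breaking.

(** * Kraus operators and conjugation by half-turns *)

Section Kraus.
Set Implicit Arguments.
Unset Strict Implicit.
Variable C : numClosedFieldType.
Implicit Types (M : 'M[C]_3) (c x y u v r s : 'cV[C]_3) (X Y A B : 'M[C]_2).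

Definition kraus M c m (K : 'I_m -> 'M[C]_2) : Prop :=
  (forall X, bloch_map M c X = \sum_k K k *m X *m adj (K k)) /\
  \sum_k adj (K k) *m K k = 1%:M.

(** Choi's construction: factor the positive Choi matrix as [V *m adj V] and reshape each column of
    [V] into a 2x2 matrix. The normalisation holds because [T] represents the trace functional. *)
Lemma cp_kraus M c : completely_positive (bloch_map M c) ->
  exists m (K : 'I_m -> 'M[C]_2), kraus M c K.
Proof.
move=> cp; pose J := tensI (bloch_map M c) (1 *: (max_ent C *m adj (max_ent C))).
have /psd_factor [V eJ] : psd J by apply: cp; rewrite scale1r; apply: psd_gram.
pose K k : 'M[C]_2 := \matrix_(i, a) V (enum_rank (i, a)) k.
have eK X : bloch_map M c X = \sum_k K k *m X *m adj (K k).
  rewrite bloch_decomp; apply/matrixP => i j; rewrite !summxE.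
  under eq_bigr => a _.
    rewrite summxE; under eq_bigr => b _.
      rewrite mxE -[bloch_map _ _ _ _ _]mul1r -tensI_max_ent -/J eJ mxE mulr_sumr.
    over.
    rewrite exchange_big /=.
  over.
  rewrite exchange_big /=; apply: eq_bigr => k _.
  by rewrite mul2E !mul2E !sum2 !mxE; ring.
exists (bdim 2), K; split=> //.
set T := \sum_k _.
have hT X : \tr (T *m X) = \tr X.
  rewrite -[RHS](tr_bloch M c) eK mulmx_suml !linear_sum /=.
  by apply: eq_bigr => k _; rewrite -mulmxA mxtrace_mulC.
apply/matrixP => a b; have := hT (delta_mx b a); rewrite !tr2 !mul2E !mxE.
move: a b; apply: all_ord2; apply: all_ord2; rewrite /=;
  rewrite ?(mulr0, mulr1, addr0, add0r); by [].
Qed.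

Lemma psd_sum m n (F : 'I_m -> 'M[C]_n) :
  (forall k, psd (F k)) -> psd (\sum_k F k).
Proof.
move=> pF; apply: (big_ind (@psd C n)) => // [v|A B pA pB v].
  by rewrite mulmx0 mul0mx mxE.
by rewrite mulmxDr mulmxDl mxE addr_ge0 ?pA ?pB.
Qed.

Lemma kraus_state M c m (K : 'I_m -> 'M[C]_2) X :
  kraus M c K -> is_state X -> is_state (bloch_map M c X).
Proof.
case=> eK _ [pX tX]; split; last by rewrite tr_bloch.
rewrite eK; apply: psd_sum => k.
by have := @psd_congr _ _ _ X (adj (K k)) pX; rewrite ctrmxK.
Qed.

Lemma kraus_ball M c m (K : 'I_m -> 'M[C]_2) x : kraus M c K ->
  real_mx x -> dot x x <= 1 -> real_mx (M *m x + c) /\ dot (M *m x + c) (M *m x + c) <= 1.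
Proof.
move=> hK rx lx; have := kraus_state hK (state_pv rx lx).
by rewrite bloch_map_pv scale1r => /state_bloch; rewrite bx_pv => -[].
Qed.

Definition e3 : 'cV[C]_3 := col3 0 0 1.

(** For a unit axis this is a symmetric involution, so it is its own inverse and transpose, and it
    lifts explicitly to the unitary [u.sigma]; no covering of SO(3) by SU(2) has to be
    constructed. *)
Definition half_turn u : 'M[C]_3 := 2 *: (u *m u^T) - 1%:M.

Definition flip u : 'M[C]_2 :=
  mk2 (u j2 0) (u j0 0 - 'i * u j1 0) (u j0 0 + 'i * u j1 0) (- u j2 0).

Lemma half_turnE u x : half_turn u *m x = (2 * dot u x) *: u - x.
Proof.
rewrite /half_turn mulmxBl mul1mx -scalemxAl -mulmxA.
congr (_ - _); rewrite -scalerA; congr (_ *: _).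
by apply/colP => i; rewrite !mxE big_ord1 mxE sum3 !mxE /dot mulrC.
Qed.

Lemma half_turn_tr u : (half_turn u)^T = half_turn u.
Proof. by apply/matrixP => i j; rewrite !mxE !big_ord1 !mxE eq_sym [X in 2 * X]mulrC. Qed.

Lemma half_turnK u : dot u u = 1 -> half_turn u *m half_turn u = 1%:M.
Proof.
move=> u1; apply: mulmx_ext => x.
rewrite -mulmxA mul1mx !half_turnE dotDr dotZr u1 dotNr.
by apply: col3_eq; rewrite !mxE; ring.
Qed.

Lemma det2 (A : 'M[C]_2) : \det A = A i0 i0 * A i1 i1 - A i0 i1 * A i1 i0.
Proof.
rewrite (expand_det_row _ i0) sum2 /cofactor !det_mx11 !mxE /=.
have -> : lift i0 0 = i1 by apply: val_inj.
have -> : lift i1 0 = i0 by apply: val_inj.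
by rewrite expr0 expr1; ring.
Qed.

Lemma det3 (A : 'M[C]_3) : \det A =
  A j0 j0 * (A j1 j1 * A j2 j2 - A j1 j2 * A j2 j1)
  - A j0 j1 * (A j1 j0 * A j2 j2 - A j1 j2 * A j2 j0)
  + A j0 j2 * (A j1 j0 * A j2 j1 - A j1 j1 * A j2 j0).
Proof.
rewrite (expand_det_row _ j0) sum3 /cofactor !det2 !mxE /=.
have f1 : lift j0 i0 = j1 by apply: val_inj.
have f2 : lift j0 i1 = j2 by apply: val_inj.
have f3 : lift j1 i0 = j0 by apply: val_inj.
have f4 : lift j1 i1 = j2 by apply: val_inj.
have f5 : lift j2 i0 = j0 by apply: val_inj.
have f6 : lift j2 i1 = j1 by apply: val_inj.
by rewrite !(f1, f2, f3, f4, f5, f6) expr0 expr1 sqrrN expr1n; ring.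
Qed.

Lemma half_turn_SO3 u : real_mx u -> dot u u = 1 -> SO3 (half_turn u).
Proof.
move=> ru u1; split; last split.
- by move=> i j; rewrite !mxE big_ord1 !mxE rpredB ?rpredM ?ru ?rpred_nat.
- by rewrite half_turn_tr half_turnK.
rewrite det3 !mxE !big_ord1 !mxE /=.
(* The unit-length condition, oriented as a rule that lets [ring] eliminate the square of the first
   coordinate. *)
have e : u j0 0 * u j0 0 = 1 - u j1 0 * u j1 0 - u j2 0 * u j2 0.
  by apply: (eq_by_sub _ u1); rewrite /dot; ring.
ring: e.
Qed.

Lemma adj_flip u : real_mx u -> adj (flip u) = flip u.
Proof.
move=> ru; have h i := CrealP (ru i 0).
by apply: mx2_eq; rewrite !mxE /= ?(rmorphD, rmorphB, rmorphM, rmorphN) /= !h ?conjCi; ring.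
Qed.

Lemma flipK u : dot u u = 1 -> flip u *m flip u = 1%:M.
Proof.
rewrite /dot => u1.
have e : u j0 0 * u j0 0 = 1 - u j1 0 * u j1 0 - u j2 0 * u j2 0.
  by apply: (eq_by_sub _ u1); ring.
by apply: mx2_eq; rewrite mul2E !mxE /=; ring: (sqrCi C) e.
Qed.

(* (u.sigma) X (u.sigma) is the half-turn about u on Bloch vectors. *)
Lemma flip_pv u t x : dot u u = 1 ->
  flip u *m pv t x *m flip u = pv t (half_turn u *m x).
Proof.
rewrite half_turnE /dot => u1.
have e : u j0 0 * u j0 0 = 1 - u j1 0 * u j1 0 - u j2 0 * u j2 0.
  by apply: (eq_by_sub _ u1); ring.
by apply: mx2_eq; rewrite !mul2E !mxE /=; field: (sqrCi C) e.
Qed.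

Lemma flip_bloch u M c X : dot u u = 1 ->
  bloch_map (half_turn u *m M *m half_turn u) (half_turn u *m c) X =
  flip u *m bloch_map M c (flip u *m X *m flip u) *m flip u.
Proof.
move=> u1; rewrite -[X in RHS]pv_bx flip_pv // bloch_map_pv flip_pv //.
by rewrite bloch_mapE mulmxDr -scalemxAr !mulmxA.
Qed.

Lemma kraus_half_turn u M c m (K : 'I_m -> 'M[C]_2) :
  real_mx u -> dot u u = 1 -> kraus M c K ->
  kraus (half_turn u *m M *m half_turn u) (half_turn u *m c)
    (fun k => flip u *m K k *m flip u).
Proof.
move=> ru u1 [eK tK]; split=> [X|].
  rewrite flip_bloch // eK mulmx_sumr mulmx_suml; apply: eq_bigr => k _.
  by rewrite !ctrmxM adj_flip // !mulmxA.
transitivity (flip u *m 1%:M *m flip u); last by rewrite mulmx1 flipK.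
rewrite -tK mulmx_sumr mulmx_suml; apply: eq_bigr => k _.
rewrite !ctrmxM adj_flip // !mulmxA; congr (_ *m _ *m _).
by rewrite -[LHS]mulmxA flipK // mulmx1.
Qed.

Lemma half_turnKV u M c : dot u u = 1 ->
  half_turn u *m (half_turn u *m M *m half_turn u) *m half_turn u = M /\
  half_turn u *m (half_turn u *m c) = c.
Proof.
move=> u1; rewrite !mulmxA half_turnK // !mul1mx; split=> //.
by rewrite -mulmxA half_turnK // mulmx1.
Qed.

Lemma measure_prepare_half_turn u M c : real_mx u -> dot u u = 1 ->
  measure_prepare (bloch_map (half_turn u *m M *m half_turn u) (half_turn u *m c)) ->
  measure_prepare (bloch_map M c).
Proof.
move=> ru u1 [m [f [R [sR e]]]].
exists m, (fun k => flip u *m f k), (fun k => flip u *m R k *m flip u).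
split=> [k|X].
  have [eR rk lk] := state_bloch (sR k); rewrite eR flip_pv //.
  have [rh [oh _]] := half_turn_SO3 ru u1.
  apply: state_pv; first by apply: (real_mxM rh rk).
  rewrite half_turnE; move: lk; congr (_ <= _).
  move: u1; rewrite /dot !mxE; set a := u j0 0; set b := u j1 0; set d := u j2 0.
  move=> u1; have e' : a * a = 1 - b * b - d * d.
    by apply: (eq_by_sub _ u1); ring.
  ring: e'.
have [{1}<- {1}<-] := half_turnKV M c u1.
rewrite flip_bloch // e mulmx_sumr mulmx_suml; apply: eq_bigr => k _.
rewrite -scalemxAr -scalemxAl; congr (_ *: _).
by rewrite ctrmxM adj_flip // !mulmxA.
Qed.

(** The axis bisects the angle between the pole and [r]: it is [e3 + r] divided by its length [n],
    where [n ^+ 2 = 2 (1 + r_z)]. At the south pole this sum vanishes and a horizontal axis is taken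
    instead. *)
Lemma half_turn_to r : real_mx r -> dot r r = 1 ->
  exists u, [/\ real_mx u, dot u u = 1 & half_turn u *m e3 = r].
Proof.
move=> rr r1.
have hu (a b d : C) : a \is Num.real -> b \is Num.real -> d \is Num.real ->
    real_mx (col3 a b d).
  by move=> ra rb rd i j; rewrite mxE; case: (val i) => [|[]].
have re3 : real_mx e3 by apply: hu.
have e33 : dot e3 e3 = 1 by rewrite /dot !mxE /=; ring.
have r2 : dot r e3 = r j2 0 by rewrite /dot !mxE /=; ring.
have [h2|h2] := eqVneq (1 + r j2 0) 0.
  have : r = - e3.
    have rd := real_mxD rr re3; apply/eqP; rewrite -subr_eq0 opprK.
    apply/eqP/dot_eq0 => //; rewrite !dotDl !dotDr r1 e33 [dot e3 r]dotC r2.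
    by rewrite [_ + 1]addrC h2 addr0.
  move=> ->; exists (col3 1 0 0); split; first exact: hu.
    by rewrite /dot !mxE /=; ring.
  by rewrite half_turnE /dot; apply: col3_eq; rewrite !mxE /=; ring.
have p2 : 0 < 1 + r j2 0.
  have Ne33 : dot (- e3) (- e3) = 1 by rewrite dotNl dotNr opprK.
  have lr : dot r r <= 1 by rewrite r1.
  rewrite lt_def h2 /= -r2; have [+ _] := ball_dot_le1 rr (real_mxN re3) lr Ne33.
  by rewrite dotNl dotC -subr_ge0 opprK.
pose n := sqrtC (2 * (1 + r j2 0)).
have n2 : n ^+ 2 = 2 * (1 + r j2 0) by rewrite sqrtCK.
have n_gt0 : 0 < n by rewrite sqrtC_gt0 mulr_gt0.
have n0 : n != 0 by rewrite gt_eqF.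
exists (n^-1 *: (e3 + r)); split.
- by apply: real_mxZ; [rewrite rpredV gtr0_real | apply: real_mxD].
- rewrite dotZl dotZr !dotDl !dotDr r1 e33 [dot e3 r]dotC r2.
  apply: (mulfI (expf_neq0 2 n0)); rewrite mulr1 {2}n2 expr2.
  by field.
rewrite half_turnE dotZl dotDl e33 r2 scalerA.
rewrite (_ : 2 * _ * _ = 1); first by rewrite scale1r [e3 + r]addrC addrK.
apply: (mulfI (expf_neq0 2 n0)); rewrite mulr1 {2}n2 expr2.
by field.
Qed.

End Kraus.

(** * Normal forms of channels that fix or exchange the poles *)

Section NormalForms.
Set Implicit Arguments.
Unset Strict Implicit.
Variable C : numClosedFieldType.
Implicit Types (M O : 'M[C]_3) (c x y u v r s : 'cV[C]_3) (X Y A B : 'M[C]_2).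

(** The pair [ct], [st] stands for the cosine and sine of theta: an angle is encoded by its real
    point on the unit circle. *)
Definition fixing_form M c : Prop :=
  exists (O : 'M[C]_3) (ct st lam mu al : C),
      [/\ SO3 O, ct \is Num.real, st \is Num.real, ct ^+ 2 + st ^+ 2 = 1 &
       [/\ 0 < lam <= 1, lam ^+ 2 <= mu <= 1,
           0 <= al /\ al ^+ 2 <= (1 - mu) * (mu - lam ^+ 2),
           M = O *m mk3 (lam * ct) (lam * st) al
                        (- (lam * st)) (lam * ct) 0
                        0 0 mu *m O^T &
           c = O *m col3 (- al) 0 (1 - mu)]].

Definition swapping_form M c : Prop :=
  c = 0 /\
   exists (O : 'M[C]_3) (ct st lam : C),
      [/\ SO3 O, ct \is Num.real, st \is Num.real, ct ^+ 2 + st ^+ 2 = 1 &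
       [/\ 0 < lam <= 1 &
           M = O *m mk3 (lam * ct) (lam * st) 0
                        (lam * st) (- (lam * ct)) 0
                        0 0 (-1) *m O^T]].

Lemma SO3M O O' : SO3 O -> SO3 O' -> SO3 (O *m O').
Proof.
move=> [rO [oO dO]] [rO' [oO' dO']]; split; first exact: real_mxM.
rewrite trmx_mul -mulmxA (mulmxA O^T) oO mul1mx oO'; split=> //.
by rewrite det_mulmx dO dO' mulr1.
Qed.

Lemma fixing_form_conj O M c : SO3 O -> fixing_form M c ->
  fixing_form (O *m M *m O^T) (O *m c).
Proof.
move=> sO [O' [ct [st [lam [mu [al [sO' rc rs e [h1 h2 h3 -> ->]]]]]]]].
exists (O *m O'), ct, st, lam, mu, al; split=> //; first exact: SO3M.
by rewrite trmx_mul !mulmxA.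
Qed.

Lemma swapping_form_conj O M c : SO3 O -> swapping_form M c ->
  swapping_form (O *m M *m O^T) (O *m c).
Proof.
move=> sO [-> [O' [ct [st [lam [sO' rc rs e [h1 ->]]]]]]].
split; first by rewrite mulmx0.
exists (O *m O'), ct, st, lam; split=> //; first exact: SO3M.
by rewrite trmx_mul !mulmxA.
Qed.

(** The inner product over Kraus labels: each matrix position gives a vector indexed by [k], and the
    channel depends only on the Gram matrix of these four vectors. *)
Definition herm_sum m (f g : 'I_m -> C) : C := \sum_k f k * (g k)^*.

Lemma herm_sum_conj m (f g : 'I_m -> C) : (herm_sum f g)^* = herm_sum g f.
Proof.
by rewrite rmorph_sum; apply: eq_bigr => k _; rewrite rmorphM /= conjCK mulrC.
Qed.

Lemma herm_sum_ge0 m (f : 'I_m -> C) : 0 <= herm_sum f f.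
Proof. by apply: sumr_ge0 => k _; rewrite mul_conjC_ge0. Qed.

Lemma herm_sum_eq0 m (f : 'I_m -> C) : herm_sum f f = 0 -> forall k, f k = 0.
Proof.
move/eqP; rewrite psumr_eq0 => [/allP h k|k _]; last by rewrite mul_conjC_ge0.
by have /= := h k (mem_index_enum k); rewrite mul_conjC_eq0 => /eqP.
Qed.

Lemma herm_sumBl m (f g h : 'I_m -> C) a :
  herm_sum (fun k => f k - a * g k) h = herm_sum f h - a * herm_sum g h.
Proof.
by rewrite mulr_sumr -sumrB; apply: eq_bigr => k _; rewrite mulrBl mulrA.
Qed.

Lemma herm_sumBr m (f g h : 'I_m -> C) a :
  herm_sum h (fun k => f k - a * g k) = herm_sum h f - a^* * herm_sum h g.
Proof.
by rewrite -herm_sum_conj herm_sumBl rmorphB rmorphM /= !herm_sum_conj.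
Qed.

Lemma herm_sum_CS m (f g : 'I_m -> C) :
  herm_sum f g * (herm_sum f g)^* <= herm_sum f f * herm_sum g g.
Proof.
set s := herm_sum f g; set N := herm_sum g g.
have N0 : 0 <= N by apply: herm_sum_ge0.
have rN := CrealP (ger0_real N0).
have sg : herm_sum g f = s^* by rewrite herm_sum_conj.
have [N_gt0|N_le0] := boolP (0 < N).
  have N1 : N != 0 by rewrite gt_eqF.
  have := herm_sum_ge0 (fun k => f k - (s / N) * g k).
  rewrite herm_sumBr !herm_sumBl sg -/s -/N rmorphM /= fmorphV /= rN.
  rewrite -(pmulr_rge0 _ N_gt0) => h; rewrite -subr_ge0; move: h.
  by congr (0 <= _); field.
have eN : N = 0 by apply/eqP; move: N_le0; rewrite lt_def N0 andbT negbK.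
have g0 := herm_sum_eq0 eN.
have -> : s = 0 by apply: big1 => k _; rewrite g0 conjC0 mulr0.
by rewrite mul0r eN mulr0.
Qed.

Section Entries.
Variables (M : 'M[C]_3) (c : 'cV[C]_3) (m : nat) (K : 'I_m -> 'M[C]_2).
Hypothesis hK : kraus M c K.
(** The coefficient of [X a b] in the output entry [(i, j)]. *)
Let G i a j b := herm_sum (fun k => K k i a) (fun k => K k j b).

Lemma kraus_entry X i j : bloch_map M c X i j =
  X i0 i0 * G i i0 j i0 + X i0 i1 * G i i0 j i1 +
  (X i1 i0 * G i i1 j i0 + X i1 i1 * G i i1 j i1).
Proof.
rewrite hK.1 summxE !mulr_sumr -!big_split /=; apply: eq_bigr => k _.
by rewrite !mul2E !mxE; ring.
Qed.

Lemma kraus_tp a b : G i0 b i0 a + G i1 b i1 a = (a == b)%:R.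
Proof.
have := hK.2 => /matrixP /(_ a b); rewrite [RHS]mxE => <-.
rewrite summxE -big_split /=; apply: eq_bigr => k _.
by rewrite mul2E !mxE; ring.
Qed.
End Entries.

Lemma conj_half : (2^-1 : C)^* = 2^-1.
Proof. by apply/CrealP; rewrite rpredV rpred_nat. Qed.

Lemma real_part_real (z : C) : (z + z^*) / 2 \is Num.real.
Proof. by apply/CrealP; rewrite rmorphM rmorphD /= conjCK conj_half; ring. Qed.

Lemma imag_part_real (z : C) : 'i * (z^* - z) / 2 \is Num.real.
Proof.
by apply/CrealP; rewrite !rmorphM rmorphB /= conjCK conj_half conjCi; ring.
Qed.

(** The two quotients on the left are the real and imaginary part of [z]; dividing them by [|z|]
    gives the point on the circle, and angle zero serves for [z = 0]. *)
Lemma polar (z : C) : exists ct st : C,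
  [/\ ct \is Num.real, st \is Num.real, ct ^+ 2 + st ^+ 2 = 1 &
      (z + z^*) / 2 = `|z| * ct /\ 'i * (z^* - z) / 2 = `|z| * st].
Proof.
have [->|z0] := eqVneq z 0.
  exists 1, 0; split; rewrite ?rpred0 ?rpred1 //; first by ring.
  by rewrite conjC0 normr0; split; ring.
have n0 : `|z| != 0 by rewrite normr_eq0.
exists ((z + z^*) / 2 / `|z|), ('i * (z^* - z) / 2 / `|z|); split.
- by rewrite rpredM ?real_part_real // rpredV normr_real.
- by rewrite rpredM ?imag_part_real // rpredV normr_real.
- apply: (mulfI (expf_neq0 2 n0)); rewrite mulr1 [RHS]normCK.
  by field: (sqrCi C).
by split; field.
Qed.

Lemma measure_prepare_classical M c R0 R1 : is_state R0 -> is_state R1 ->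
  (forall X, bloch_map M c X = X i0 i0 *: R0 + X i1 i1 *: R1) ->
  measure_prepare (bloch_map M c).
Proof.
move=> s0 s1 e; exists 2, (fun k => delta_mx k 0), (fun k => if k == i0 then R0 else R1).
split; first by apply: all_ord2.
move=> X; rewrite sum2 e /=.
by rewrite !quad2E !mxE /= conjC0 conjC1; congr (_ *: _ + _ *: _); ring.
Qed.

Lemma rot_z_SO3 (p q : C) : p \is Num.real -> q \is Num.real -> p ^+ 2 + q ^+ 2 = 1 ->
  SO3 (mk3 p (- q) 0 q p 0 0 0 1).
Proof.
move=> rp rq e; have e' : p * p = 1 - q * q by apply: (eq_by_sub _ e); ring.
split; last split.
- move=> i j; rewrite mxE.
  by case: (val i) => [|[]]; case: (val j) => [|[]]; rewrite ?rpredN ?rpred0 ?rpred1.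
- apply/matrixP; apply: all_ord3; apply: all_ord3; rewrite mul3E !mxE /=;
    by ring: e'.
by rewrite det3 !mxE /=; ring: e'.
Qed.

Lemma state_delta (i : 'I_2) : is_state (delta_mx i i : 'M[C]_2).
Proof.
split.
  rewrite (_ : delta_mx i i = delta_mx i 0 *m adj (delta_mx i 0 : 'cV[C]_2)).
    exact: psd_gram.
  by rewrite adj_delta mul_delta_mx.
by move: i; apply: all_ord2; rewrite tr2 !mxE /=; ring.
Qed.

Lemma pv_e3 : pv 1 (e3 C) = delta_mx i0 i0.
Proof. by apply: mx2_eq; rewrite !mxE /=; field. Qed.

Lemma pv_Ne3 : pv 1 (- e3 C) = delta_mx i1 i1.
Proof. by apply: mx2_eq; rewrite !mxE /=; field. Qed.

Lemma kraus_fixing_e3 M c m (K : 'I_m -> 'M[C]_2) :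
  kraus M c K -> M *m e3 C + c = e3 C ->
  measure_prepare (bloch_map M c) \/ fixing_form M c.
Proof.
move=> hK he.
have h00 : bloch_map M c (delta_mx i0 i0) = delta_mx i0 i0.
  by rewrite -pv_e3 bloch_map_pv scale1r he.
pose G i a j b := herm_sum (fun k => K k i a) (fun k => K k j b).
have eG X i j : bloch_map M c X i j = X i0 i0 * G i i0 j i0 + X i0 i1 * G i i0 j i1 +
  (X i1 i0 * G i i1 j i0 + X i1 i1 * G i i1 j i1) by apply: kraus_entry.
have Gc i a j b : (G i a j b)^* = G j b i a by apply: herm_sum_conj.
have Gtp a b : G i0 b i0 a + G i1 b i1 a = (a == b)%:R by apply: (kraus_tp hK).
have g0 k : K k i1 i0 = 0.
  apply: (@herm_sum_eq0 _ (fun k => K k i1 i0)); move/matrixP: h00 => /(_ i1 i1).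
  by rewrite eG !mxE /= !(mul0r, mul1r, addr0).
have G0 j b : G i1 i0 j b = 0 by apply: big1 => k _; rewrite g0 mul0r.
have G0' j b : G j b i1 i0 = 0 by rewrite -Gc G0 conjC0.
(* The coherence [z] yields lambda and theta, [mu] is the probability that the south pole survives,
   and [be] has modulus alpha. *)
pose z := G i0 i0 i1 i1; pose be := G i0 i1 i1 i1; pose mu := G i1 i1 i1 i1.
have k1 : G i0 i0 i0 i0 = 1 by have := Gtp i0 i0; rewrite G0 addr0.
have kb : G i0 i0 i0 i1 = 0 by have := Gtp i1 i0; rewrite G0 addr0.
have bk : G i0 i1 i0 i0 = 0 by rewrite -Gc kb conjC0.
have bb : G i0 i1 i0 i1 = 1 - mu by rewrite -[1](Gtp i1 i1) addrK.
have zc : G i1 i1 i0 i0 = z^* by rewrite Gc.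
have bc : G i1 i1 i0 i1 = be^* by rewrite Gc.
have mu0 : 0 <= mu by apply: herm_sum_ge0.
have mu1 : 0 <= 1 - mu by rewrite -bb; apply: herm_sum_ge0.
(* Gram-Schmidt: over the Kraus labels the (0,0) entries form a unit vector by [k1], and this is the
   squared norm of the (1,1) vector minus its projection on it. *)
have muz : 0 <= mu - `|z| ^+ 2.
  have := herm_sum_ge0 (fun k => K k i1 i1 - z^* * K k i0 i0).
  rewrite herm_sumBr !herm_sumBl -/(G i1 i1 i1 i1) -/(G i1 i1 i0 i0).
  rewrite -/(G i0 i0 i0 i0) -/(G i0 i0 i1 i1) k1 zc conjCK normCK -/z -/mu.
  by congr (0 <= _); ring.
(* Trace preservation makes the (0,1) vector orthogonal to the (0,0) vector, so [be] is unchanged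
   when the (1,1) vector is replaced by its residual; Cauchy-Schwarz with the residual gives the
   sharp factor [mu - |z|^2]. *)
have beb : `|be| ^+ 2 <= (1 - mu) * (mu - `|z| ^+ 2).
  have := herm_sum_CS (fun k => K k i0 i1) (fun k => K k i1 i1 - z^* * K k i0 i0).
  rewrite !herm_sumBr !herm_sumBl -/(G i1 i1 i1 i1) -/(G i1 i1 i0 i0).
  rewrite -/(G i0 i0 i0 i0) -/(G i0 i0 i1 i1) -/(G i0 i1 i0 i1) -/(G i0 i1 i1 i1).
  rewrite -/(G i0 i1 i0 i0) bb bk k1 zc !conjCK mulr0 subr0 -/z -/mu -/be => h.
  by rewrite !normCK; move: h; congr (_ <= _ * _); ring.
have [z0|z0] := eqVneq z 0.
  left; apply: (@measure_prepare_classical _ _ (delta_mx i0 i0)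
    (bloch_map M c (delta_mx i1 i1))).
  - exact: state_delta.
  - exact: kraus_state hK (state_delta i1).
  move=> X; apply: mx2_eq; rewrite eG [RHS]mxE [Y in _ = Y + _]mxE [Y in _ = _ + Y]mxE eG !mxE /=;
    rewrite ?(G0, G0', k1, kb, bk, zc) -?/z ?z0 ?conjC0; ring.
right; have [ct [st [rc rs e1 [ec es]]]] := polar z.
(* The horizontal part of the third column of [M] is [- be^*] as a complex number. A rotation about
   the vertical axis brings it to [(alpha, 0)] with [alpha >= 0], and commutes with the horizontal
   block. *)
have [p [q [rp rq e2 [ep eqq]]]] := polar (- be^*).
rewrite normrN norm_conjC in ep eqq.
exists (mk3 p (- q) 0 q p 0 0 0 1), ct, st, `|z|, mu, `|be|.
have e2' : p * p = 1 - q * q by apply: (eq_by_sub _ e2); ring.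
have ep' : (- be + - be^*) / 2 = `|be| * p by rewrite -ep rmorphN /= conjCK addrC.
have eq' : 'i * (be^* - be) / 2 = `|be| * q.
  by rewrite -eqq rmorphN /= conjCK opprK addrC.
set P := mk3 _ _ _ _ _ _ _ _ _; set Q := mk3 _ _ _ _ _ _ _ _ _.
have eM : P *m Q *m P^T = mk3 (`|z| * ct) (`|z| * st) (`|be| * p)
   (- (`|z| * st)) (`|z| * ct) (`|be| * q) 0 0 mu.
  apply/matrixP; apply: all_ord3; apply: all_ord3; rewrite !mul3E !mxE /=;
    by ring: e2'.
have ec' : P *m col3 (- `|be|) 0 (1 - mu) = col3 (- (`|be| * p)) (- (`|be| * q)) (1 - mu).
  by apply: col3_eq; rewrite !mul3E !mxE /=; ring.
have [eM0 ec0] : M = P *m Q *m P^T /\ c = P *m col3 (- `|be|) 0 (1 - mu).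
  rewrite eM ec' -ec -es -ep' -eq'; apply: bloch_ext => X.
  rewrite [RHS]bloch_mapE bxE tr2; apply: mx2_eq; rewrite eG;
    rewrite ?(G0, G0', k1, kb, bk, bb, zc, bc) -/z -/be -/mu !mxE !sum3 !mxE /=;
    by field: (sqrCi C).
split=> //; first exact: rot_z_SO3.
have lz1 : `|z| <= 1.
  rewrite -ler_sqr ?nnegrE ?ler01 // expr1n -subr_ge0.
  by rewrite -[1](subrK mu) -addrA addr_ge0.
by split=> //; rewrite ?normr_gt0 ?z0 // -subr_ge0 muz -subr_ge0.
Qed.

(** Exchanging the poles forces every [K k] to be antidiagonal with both entry vectors of norm one,
    so the coherence [z] is the only parameter and no further rotation is needed. *)
Lemma kraus_swapping_e3 M m (K : 'I_m -> 'M[C]_2) :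
  kraus M 0 K -> M *m e3 C = - e3 C ->
  measure_prepare (bloch_map M 0) \/ swapping_form M 0.
Proof.
move=> hK he.
have h00 : bloch_map M 0 (delta_mx i0 i0) = delta_mx i1 i1.
  by rewrite -pv_e3 bloch_map_pv scale1r he addr0 pv_Ne3.
have h11 : bloch_map M 0 (delta_mx i1 i1) = delta_mx i0 i0.
  by rewrite -pv_Ne3 bloch_map_pv scale1r mulmxN he opprK addr0 pv_e3.
pose G i a j b := herm_sum (fun k => K k i a) (fun k => K k j b).
have eG X i j : bloch_map M 0 X i j = X i0 i0 * G i i0 j i0 + X i0 i1 * G i i0 j i1 +
  (X i1 i0 * G i i1 j i0 + X i1 i1 * G i i1 j i1) by apply: kraus_entry.
have Gc i a j b : (G i a j b)^* = G j b i a by apply: herm_sum_conj.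
have Gtp a b : G i0 b i0 a + G i1 b i1 a = (a == b)%:R by apply: (kraus_tp hK).
have g0 k : K k i0 i0 = 0.
  apply: (@herm_sum_eq0 _ (fun k => K k i0 i0)); move/matrixP: h00 => /(_ i0 i0).
  by rewrite eG !mxE /= !(mul0r, mul1r, addr0).
have g1 k : K k i1 i1 = 0.
  apply: (@herm_sum_eq0 _ (fun k => K k i1 i1)); move/matrixP: h11 => /(_ i1 i1).
  by rewrite eG !mxE /= !(mul0r, mul1r, addr0, add0r).
have G0 j b : G i0 i0 j b = 0 by apply: big1 => k _; rewrite g0 mul0r.
have G0' j b : G j b i0 i0 = 0 by rewrite -Gc G0 conjC0.
have G1 j b : G i1 i1 j b = 0 by apply: big1 => k _; rewrite g1 mul0r.
have G1' j b : G j b i1 i1 = 0 by rewrite -Gc G1 conjC0.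
pose z := G i1 i0 i0 i1.
have zc : G i0 i1 i1 i0 = z^* by rewrite Gc.
have kk : G i1 i0 i1 i0 = 1 by have := Gtp i0 i0; rewrite G0 add0r.
have bb : G i0 i1 i0 i1 = 1 by have := Gtp i1 i1; rewrite G1 addr0.
have [z0|z0] := eqVneq z 0.
  left; apply: (@measure_prepare_classical _ _ (delta_mx i1 i1) (delta_mx i0 i0)).
  - exact: state_delta.
  - exact: state_delta.
  move=> X; apply: mx2_eq; rewrite eG !mxE /=;
    rewrite ?(G0, G0', G1, G1', kk, bb, zc) -?/z ?z0 ?conjC0; ring.
right; have [ct [st [rc rs e1 [ec es]]]] := polar z.
split=> //; exists 1%:M, ct, st, `|z|; split=> //.
  split; last by rewrite trmx1 mulmx1 det1.
  by move=> i j; rewrite mxE rpred_nat.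
split.
  rewrite normr_gt0 z0 /= -ler_sqr ?nnegrE ?ler01 // normCK expr1n.
  have := herm_sum_CS (fun k => K k i1 i0) (fun k => K k i0 i1).
  by rewrite -/(G i1 i0 i0 i1) -/(G i1 i0 i1 i0) -/(G i0 i1 i0 i1) kk bb mulr1.
rewrite trmx1 mulmx1 mul1mx -ec -es; apply: (proj1 (@bloch_ext _ _ 0 _ 0 _)) => X.
rewrite [RHS]bloch_mapE bxE tr2; apply: mx2_eq; rewrite eG;
  rewrite ?(G0, G0', G1, G1', kk, bb, zc) -/z !mxE !sum3 !mxE /=;
  by field: (sqrCi C).
Qed.

End NormalForms.

(** * Fixed points and peripheral eigenvalues of a channel *)

Section FixedPoints.
Set Implicit Arguments.
Unset Strict Implicit.
Variable C : numClosedFieldType.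
Implicit Types (O : 'M[C]_3) (x y u v r s : 'cV[C]_3) (X Y A B : 'M[C]_2).

Variables (M : 'M[C]_3) (c : 'cV[C]_3) (m : nat) (K : 'I_m -> 'M[C]_2).
Hypothesis rM : real_mx M.
Hypothesis rc : real_mx c.
Hypothesis hK : kraus M c K.

Definition pure_fixed_point r := [/\ real_mx r, dot r r = 1 & M *m r + c = r].

Lemma kraus_pure_fixed_point r : pure_fixed_point r ->
  measure_prepare (bloch_map M c) \/ fixing_form M c.
Proof.
move=> [rr r1 er]; have [u [ru u1 eu]] := half_turn_to rr r1.
set H := half_turn u in eu.
have HH : H *m H = 1%:M by apply: half_turnK.
have : H *m M *m H *m e3 C + H *m c = e3 C.
  by rewrite -!mulmxA eu -mulmxDr er -eu mulmxA HH mul1mx.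
case/(kraus_fixing_e3 (kraus_half_turn ru u1 hK)) => [mp|ff].
  by left; apply: (measure_prepare_half_turn ru u1 mp).
right; have := fixing_form_conj (half_turn_SO3 ru u1) ff.
by rewrite half_turn_tr; have [-> ->] := half_turnKV M c u1.
Qed.

Lemma kraus_reversed_axis n : real_mx n -> dot n n = 1 -> M *m n = - n ->
  measure_prepare (bloch_map M c) \/ swapping_form M c.
Proof.
move=> rn n1 en.
have ln : dot n n <= 1 by rewrite n1.
have Nn1 : dot (- n) (- n) = 1 by rewrite dotNl dotNr opprK.
have lNn : dot (- n) (- n) <= 1 by rewrite Nn1.
have rNn := real_mxN rn.
(* The images [c - n] of [n] and [c + n] of [- n] both lie in the ball. Pairing them with [n] and
   [- n] forces [n.c = 0], so [n + c] reaches the value 1 against [n] and must equal [n]. *)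
have c0 : c = 0.
  have [r1 l1] := kraus_ball hK rNn lNn; have [r2 l2] := kraus_ball hK rn ln.
  rewrite mulmxN en opprK in r1 l1; rewrite en in r2 l2.
  have [h1 e1] := ball_dot_le1 r1 rn l1 n1.
  have [h2 _] := ball_dot_le1 r2 rNn l2 Nn1.
  rewrite dotDr n1 gerDl in h1; rewrite dotDr Nn1 dotNl gerDl oppr_le0 in h2.
  have nc : dot n c = 0 by apply/eqP; rewrite eq_le h1 h2.
  have /e1 /eqP : dot n (n + c) = 1 by rewrite dotDr n1 nc addr0.
  by rewrite -subr_eq0 addrC addKr => /eqP.
have hK0 : kraus M 0 K by rewrite -c0.
rewrite c0; have [u [ru u1 eu]] := half_turn_to rn n1.
set H := half_turn u in eu.
have HH : H *m H = 1%:M by apply: half_turnK.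
have := kraus_half_turn ru u1 hK0; rewrite -/H mulmx0 => hK'.
have : H *m M *m H *m e3 C = - e3 C.
  by rewrite -!mulmxA eu en -eu mulmxN mulmxA HH mul1mx.
case/(kraus_swapping_e3 hK') => [mp|sf].
  by left; apply: (measure_prepare_half_turn ru u1); rewrite mulmx0.
right; have := swapping_form_conj (half_turn_SO3 ru u1) sf.
by rewrite half_turn_tr mulmx0; have [-> _] := half_turnKV M c u1.
Qed.

Lemma normalize x : real_mx x -> x != 0 ->
  exists N, [/\ 0 < N, N ^+ 2 = dot x x, real_mx (N^-1 *: x) &
    dot (N^-1 *: x) (N^-1 *: x) = 1].
Proof.
move=> rx x0; have d0 := dot_ge0 rx.
have d_gt0 : 0 < dot x x.
  rewrite lt_def d0 andbT; apply: contra_neq x0; exact: dot_eq0.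
exists (sqrtC (dot x x)); have N_gt0 : 0 < sqrtC (dot x x) by rewrite sqrtC_gt0.
have N0 : sqrtC (dot x x) != 0 by rewrite gt_eqF.
split=> //; first by rewrite sqrtCK.
  by apply: real_mxZ => //; rewrite rpredV gtr0_real.
rewrite dotZl dotZr -{3}[dot x x]sqrtCK; by field.
Qed.

(* The Hermitian fixed operator t + x.sigma is not positive definite, so the map also
   fixes its positive part, which is a multiple of a pure state. *)
Lemma fixed_operator_pure x t : real_mx x -> x != 0 -> 0 <= t -> t ^+ 2 <= dot x x ->
  M *m x + t *: c = x -> exists r, pure_fixed_point r.
Proof.
move=> rx x0 t0 lt ex; have [N [N_gt0 eN rn n1]] := normalize rx x0.
set n := N^-1 *: x in rn n1.
have N0 : N != 0 by rewrite gt_eqF.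
have ex2 : x = N *: n by rewrite scalerA mulfV ?scale1r.
clearbody n.
have ln : dot n n <= 1 by rewrite n1.
have Nn1 : dot (- n) (- n) = 1 by rewrite dotNl dotNr opprK.
have lNn : dot (- n) (- n) <= 1 by rewrite Nn1.
have [r1 l1] := kraus_ball hK rn ln.
have [r2 l2] := kraus_ball hK (real_mxN rn) lNn.
have [h1 e1] := ball_dot_le1 r1 rn l1 n1.
have [h2 _] := ball_dot_le1 r2 (real_mxN rn) l2 Nn1.
set a := dot n (M *m n); set b := dot n c.
have h1' : 0 <= 1 - a - b by rewrite -addrA -opprD subr_ge0 /a /b -dotDr.
have h2' : 0 <= 1 - a + b.
  rewrite -[b]opprK -addrA -opprD subr_ge0; move: h2; congr (_ <= _).
  by rewrite dotDr mulmxN !dotNl dotNr opprK.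
have ha : 0 <= 1 - a.
  rewrite -(pmulr_rge0 _ (ltr0Sn C 1)).
  have -> : 2 * (1 - a) = 1 - a - b + (1 - a + b) by ring.
  exact: addr_ge0.
have tN : t <= N by rewrite -ler_sqr ?nnegrE ?(ltW N_gt0) // eN.
have eq1 : N * a + t * b = N.
  have := congr1 (dot n) ex; rewrite dotDr dotZr {1 2}ex2 -scalemxAr !dotZr -/a -/b n1.
  by rewrite mulr1.
(* The fixed-point equation along [n], split into two nonnegative terms. If [t] is nonzero, the
   second one gives [a + b = 1]; if [t = 0], the first gives [a = 1] and the two ball inequalities
   pinch [b] to 0. *)
have eq2 : (N - t) * (1 - a) + t * (1 - a - b) = 0.
  by apply: (eq_by_sub _ (esym eq1)); ring.
have ab1 : a + b = 1.
  have p1 : 0 <= (N - t) * (1 - a) by rewrite mulr_ge0 // subr_ge0.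
  have p2 : 0 <= t * (1 - a - b) by apply: mulr_ge0.
  move/eqP: eq2; rewrite (paddr_eq0 p1 p2) !mulf_eq0; case/andP => k1 /orP [/eqP t00|k2]; last first.
    by apply/esym/eqP; rewrite -subr_eq0 opprD addrA.
  move: k1; rewrite t00 subr0 (negPf N0) /= subr_eq0 => /eqP a1.
  move: h1' h2'; rewrite -a1 subrr sub0r add0r oppr_ge0 => b1 b2.
  by rewrite (_ : b = 0) ?addr0 //; apply/eqP; rewrite eq_le b1 b2.
by exists n; split=> //; apply: e1; rewrite dotDr.
Qed.

(** As [M] and [a] are real, the real part [p] and the imaginary part [q] of [x] satisfy the same
    equation, and one of them is nonzero. *)
Lemma real_eigenvector a x : a \is Num.real -> x != 0 -> M *m x = a *: x ->
  exists y, [/\ real_mx y, y != 0 & M *m y = a *: y].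
Proof.
move=> ra x0 ex; pose xc : 'cV[C]_3 := map_mx Num.conj x.
have Mc : map_mx Num.conj M = M by apply/matrixP => i j; rewrite mxE; apply/CrealP/rM.
have exc : M *m xc = a *: xc.
  rewrite -[M in LHS]Mc -map_mxM ex; apply/matrixP => i j; rewrite !mxE rmorphM /=.
  by rewrite (CrealP ra).
pose p := 2^-1 *: (x + xc); pose q := ('i / 2) *: (xc - x).
have ep : M *m p = a *: p.
  by rewrite -scalemxAr mulmxDr ex exc -scalerDr !scalerA mulrC.
have eq : M *m q = a *: q.
  by rewrite -scalemxAr mulmxBr ex exc -scalerBr !scalerA mulrC.
have rp : real_mx p by move=> i j; rewrite !mxE mulrC real_part_real.
have rq : real_mx q by move=> i j; rewrite !mxE mulrAC imag_part_real.
have [p0|p0] := eqVneq p 0; last by exists p.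
exists q; split=> //; apply: contra_neq x0 => q0.
have -> : x = p + 'i *: q by apply: col3_eq; rewrite !mxE; field: (sqrCi C).
by rewrite p0 q0 scaler0 addr0.
Qed.

Lemma singular_kernel (A : 'M[C]_3) : A \notin unitmx -> exists2 x : 'cV[C]_3, x != 0 & A *m x = 0.
Proof.
rewrite -unitmx_tr unitmxE unitfE negbK => /det0P [v v0 ev].
exists v^T; first by rewrite -(inj_eq trmx_inj) trmxK trmx0.
by apply: trmx_inj; rewrite trmx_mul trmxK ev trmx0.
Qed.

Lemma singular_sub1_pure : 1%:M - M \notin unitmx -> exists r, pure_fixed_point r.
Proof.
move=> /singular_kernel [x x0 /eqP].
rewrite mulmxBl mul1mx subr_eq0 => /eqP ex.
have ex1 : M *m x = 1 *: x by rewrite scale1r.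
have [y [ry y0 ey]] := real_eigenvector (rpred1 _) x0 ex1.
apply: (@fixed_operator_pure y 0 ry y0 (lexx 0)).
  by rewrite expr0n /= dot_ge0.
by rewrite scale0r addr0 ey scale1r.
Qed.

(** Linear algebra in place of a fixed point theorem. If [1 - M] is singular, a real kernel vector
    is a traceless fixed operator ([t = 0]). Otherwise the solution [r] is unique but not known to
    lie in the ball; if it is not interior, [1 + r.sigma] is fixed and not positive definite. Either
    way [fixed_operator_pure] applies. *)
Lemma pure_or_interior_fixed_point : (exists r, pure_fixed_point r) \/
  exists r, [/\ real_mx r, dot r r < 1 & M *m r + c = r].
Proof.
have [uM|] := boolP (1%:M - M \in unitmx); last first.
  by move/singular_sub1_pure; left.
pose r := invmx (1%:M - M) *m c.
have er' : (1%:M - M) *m r = c by rewrite mulmxA mulmxV // mul1mx.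
have er : M *m r + c = r by rewrite -[in LHS]er' mulmxBl mul1mx addrC subrK.
have rr : real_mx r.
  have e : map_mx Num.conj (1%:M - M) = 1%:M - M.
    apply/matrixP => i j; rewrite !mxE; apply/CrealP.
    by rewrite rpredB ?rM ?rpred_nat.
  have e' : map_mx Num.conj c = c by apply/matrixP => i j; rewrite mxE; apply/CrealP/rc.
  have e2 : map_mx Num.conj r = r.
    by rewrite -[LHS](mulKmx uM) -[X in X *m map_mx _ _]e -map_mxM er' e'.
  by move=> i j; apply/CrealP; have := congr1 (fun x : 'cV_3 => x i j) e2; rewrite mxE.
have [l1|l1] := boolP (1 <= dot r r); last first.
  by right; exists r; split=> //; rewrite real_ltNge ?rpred1 ?real_dot.
left; apply: (@fixed_operator_pure r 1 rr _ ler01).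
- by apply: contraTneq l1 => ->; rewrite dot0r ler10.
- by rewrite expr1n.
by rewrite scale1r.
Qed.

(** A rank-one matrix has determinant zero, so the Bloch vector of [w *m adj w] is exactly as long
    as its trace. *)
Lemma pure_vector (w : 'cV[C]_2) : w != 0 ->
  exists r a, [/\ real_mx r, dot r r = 1, a != 0 & pv 1 r = a *: (w *m adj w)].
Proof.
move=> w0; pose N := \tr (w *m adj w).
have N0 : N != 0 by apply: contra_neq w0; apply: tr_gram_eq0.
have [N_ge0 rb _] := psd_bloch (psd_gram w).
exists (N^-1 *: bx (w *m adj w)), N^-1; split.
- by apply: real_mxZ => //; rewrite rpredV ger0_real.
- have e : dot (bx (w *m adj w)) (bx (w *m adj w)) = N ^+ 2.
    by rewrite /N bxE tr2 /dot !mxE /= !big_ord1 !mxE; ring: (sqrCi C).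
  by rewrite dotZl dotZr e; field.
- by rewrite invr_eq0.
by rewrite -[X in pv X _](mulVf N0) -pvZ pv_bx.
Qed.

(** Each Kraus term rescales [w *m adj w]; trace preservation makes the total factor 1. *)
Lemma common_eigenvector_pure (w : 'cV[C]_2) : w != 0 ->
  (forall k, exists a, K k *m w = a *: w) -> exists r, pure_fixed_point r.
Proof.
move=> w0 hw; have [r [a [rr r1 a0 er]]] := pure_vector w0.
exists r; split=> //.
have /fin_all_exists [b eb] := hw.
pose s := \sum_k b k * (b k)^*.
have e : bloch_map M c (pv 1 r) = s *: pv 1 r.
  rewrite hK.1 er /s scaler_suml; apply: eq_bigr => k _.
  have -> : K k *m (a *: (w *m adj w)) *m adj (K k)
      = a *: ((K k *m w) *m adj (K k *m w)).
    by rewrite ctrmxM -scalemxAr -scalemxAl !mulmxA.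
  rewrite eb ctrmxZ.
  by rewrite -scalemxAl -scalemxAr !scalerA; congr (_ *: _); ring.
have s1 : s = 1.
  by have := congr1 mxtrace e; rewrite tr_bloch mxtraceZ tr_pv mulr1.
by move: e; rewrite s1 scale1r bloch_map_pv scale1r => /pv_inj [].
Qed.

Lemma kernel_line A (w u : 'cV[C]_2) : A != 0 -> w != 0 ->
  A *m w = 0 -> A *m u = 0 -> exists a, u = a *: w.
Proof.
move=> A0 w0 Aw Au.
(* If this determinant were nonzero, Cramer's rule would make both entries of every row of [A]
   vanish. *)
have cross : u i0 0 * w i1 0 = u i1 0 * w i0 0.
  apply/eqP; rewrite -subr_eq0; apply: contraNT A0 => d0; apply/eqP.
  have h i : A i i0 = 0 /\ A i i1 = 0.
    move: Aw Au => /colP /(_ i) + /colP /(_ i); rewrite !mxE !sum2 => ew eu.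
    split; apply: (mulfI d0); rewrite mulr0.
      transitivity (w i1 0 * (A i i0 * u i0 0 + A i i1 * u i1 0)
        - u i1 0 * (A i i0 * w i0 0 + A i i1 * w i1 0)); first by ring.
      by rewrite ew eu; ring.
    transitivity (u i0 0 * (A i i0 * w i0 0 + A i i1 * w i1 0)
      - w i0 0 * (A i i0 * u i0 0 + A i i1 * u i1 0)); first by ring.
    by rewrite ew eu; ring.
  by apply: mx2_eq; rewrite mxE; case: (h i0) => ? ?; case: (h i1).
have [z0|z0] := eqVneq (w i0 0) 0.
  have z1 : w i1 0 != 0.
    by apply: contra_neq w0 => z1; apply/colP; apply: all_ord2; rewrite mxE.
  have u0 : u i0 0 = 0 by apply: (mulIf z1); rewrite cross z0 mulr0 mul0r.
  exists (u i1 0 / w i1 0); apply/colP; apply: all_ord2; rewrite !mxE.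
    by rewrite z0 u0 mulr0.
  by field.
exists (u i0 0 / w i0 0); apply/colP; apply: all_ord2; rewrite !mxE; first by field.
by apply: (mulIf z0); rewrite -cross; field.
Qed.

Lemma trace_form_inj A B : (forall X, \tr (A *m X) = \tr (B *m X)) -> A = B.
Proof.
move=> h; apply/matrixP => a b; have := h (delta_mx b a); rewrite !tr2 !mul2E !mxE.
by move: a b; apply: all_ord2; apply: all_ord2; rewrite /=;
  rewrite ?(mulr0, mulr1, addr0, add0r).
Qed.

Lemma faithful_state r (V : 'M[C]_2) : real_mx r -> dot r r < 1 ->
  0 <= \tr (pv 1 r *m (adj V *m V)) /\
  (\tr (pv 1 r *m (adj V *m V)) = 0 -> V = 0).
Proof.
move=> rr lr; have pr : psd (pv 1 r).
  by apply: psd_pv; rewrite ?expr1n // ltW.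
have [W eW] := psd_factor pr.
have -> : \tr (pv 1 r *m (adj V *m V)) = \tr (V *m W *m adj (V *m W)).
  by rewrite ctrmxM eW mxtrace_mulC -!mulmxA mxtrace_mulC !mulmxA.
split; first by apply/psd_tr_ge0/psd_gram.
move/tr_gram_eq0 => h; have h0 : V *m pv 1 r = 0 by rewrite eW mulmxA h mul0mx.
(* Reversing the Bloch vector gives the adjugate, so an interior state is invertible and can be
   cancelled from [V *m pv 1 r = 0]. *)
have e : pv 1 r *m pv 1 (- r) = ((1 - dot r r) / 4)%:M.
  by apply: mx2_eq; rewrite mul2E !mxE /dot /=; field: (sqrCi C).
have := congr1 (mulmx^~ (pv 1 (- r))) h0; rewrite mul0mx -mulmxA e mul_mx_scalar.
move/eqP; rewrite scaler_eq0 mulf_eq0 invr_eq0 pnatr_eq0 orbF subr_eq0.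
by rewrite eq_sym lt_eqF //= => /eqP.
Qed.

(* Kadison-Schwarz with equality: a peripheral eigenoperator of the dual map
   intertwines every Kraus operator. *)
Lemma peripheral_commute r A a : real_mx r -> dot r r < 1 -> M *m r + c = r ->
  1 <= `|a| -> (forall X, \tr (A *m bloch_map M c X) = a * \tr (A *m X)) ->
  forall k, A *m K k = a *: (K k *m A).
Proof.
move=> rr lr er a1 hA k.
have dualE B X : \tr (B *m bloch_map M c X) = \tr ((\sum_k adj (K k) *m B *m K k) *m X).
  rewrite hK.1 mulmx_sumr mulmx_suml !linear_sum /=; apply: eq_bigr => i _.
  by rewrite !mulmxA mxtrace_mulC !mulmxA.
have eA : \sum_k adj (K k) *m A *m K k = a *: A.
  by apply: trace_form_inj => X; rewrite -dualE hA -scalemxAl mxtraceZ.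
have eA' : \sum_k adj (K k) *m adj A *m K k = a^* *: adj A.
  rewrite -ctrmxZ -eA ctrmx_sum; apply: eq_bigr => k' _.
  by rewrite !ctrmxM ctrmxK mulmxA.
pose Yk k := A *m K k - a *: (K k *m A).
have sumY : \sum_k adj (Yk k) *m Yk k =
    \sum_k adj (K k) *m (adj A *m A) *m K k - (a^* * a) *: (adj A *m A).
  transitivity (\sum_k (adj (K k) *m (adj A *m A) *m K k
     - a *: (adj (K k) *m adj A *m K k *m A)
     - a^* *: (adj A *m (adj (K k) *m A *m K k))
     + (a^* * a) *: (adj A *m (adj (K k) *m K k) *m A))).
    apply: eq_bigr => i _; rewrite /Yk.
    rewrite ctrmxD -scaleNr ctrmxZ !ctrmxM mulmxDl !mulmxDr -!scalemxAl -!scalemxAr !scalerA.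
    rewrite !mulmxA rmorphN mulrNN !scaleNr !addrA; congr (_ + _).
  rewrite big_split /= !sumrB -!scaler_sumr -!mulmx_suml -!mulmx_sumr eA eA' hK.2.
  rewrite mulmx1 -!scalemxAl -!scalemxAr !scalerA [a * a^*]mulrC.
  by rewrite addrNK.
(* The state [r] is invariant, so the dual map drops out of the expectation of [sumY]. What is left
   is at most 0 as [|a| >= 1], while each summand is nonnegative. *)
have trY : \sum_k \tr (pv 1 r *m (adj (Yk k) *m Yk k)) =
    (1 - `|a| ^+ 2) * \tr (pv 1 r *m (adj A *m A)).
  rewrite -linear_sum -mulmx_sumr sumY mulmxBr linearB /= mxtrace_mulC -dualE.
  rewrite bloch_map_pv scale1r er mxtrace_mulC -scalemxAr mxtraceZ mulrBl mul1r.
  by rewrite normCK [a * _]mulrC.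
have Y0 i : 0 <= \tr (pv 1 r *m (adj (Yk i) *m Yk i)) by case: (faithful_state (Yk i) rr lr).
have : \sum_k \tr (pv 1 r *m (adj (Yk k) *m Yk k)) = 0.
  apply/eqP; rewrite eq_le sumr_ge0 ?andbT // trY.
  have [t0 _] := faithful_state A rr lr; rewrite mulr_le0_ge0 // subr_le0.
  by rewrite expr_ge1.
move/eqP; rewrite psumr_eq0 // => /allP /(_ k (mem_index_enum k)) /= /eqP.
by case: (faithful_state (Yk k) rr lr) => _ /[apply] /eqP; rewrite subr_eq0 => /eqP.
Qed.

Lemma peripheral_eigenvalue r (y : 'rV[C]_3) a : real_mx r -> dot r r < 1 -> M *m r + c = r ->
  y != 0 -> y *m M = a *: y -> 1 <= `|a| ->
  a = -1 \/ exists s, pure_fixed_point s.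
Proof.
move=> rr lr er y0 ey a1.
have a0 : a != 0 by apply: contraTneq a1 => ->; rewrite normr0 ler10.
(* The scalar part makes [A] have expectation zero in the fixed state; this turns the left
   eigenvector of [M] into an eigenoperator of the dual map even when [c] is nonzero. *)
pose t := - dot y^T r; pose A := pv t y^T.
have yM x : dot y^T (M *m x) = a * dot y^T x.
  have h z : dot y^T z = (y *m z) 0 0 by rewrite mul3E /dot !mxE.
  by rewrite !h mulmxA ey -scalemxAl mxE.
have [ea|na1] := eqVneq a 1.
  right; apply: singular_sub1_pure; rewrite unitmxE unitfE negbK.
  by apply/det0P; exists y => //; rewrite mulmxBr mulmx1 ey ea scale1r subrr.
have hA X : \tr (A *m bloch_map M c X) = a * \tr (A *m X).
  rewrite bloch_mapE -{4}[X]pv_bx !tr_mul_pv dotDr yM dotZr.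
  have -> : dot y^T c = (1 - a) * dot y^T r.
    rewrite mulrBl mul1r -yM -{1}er dotDr; ring.
  by rewrite /t; ring.
have comm := peripheral_commute rr lr er a1 hA.
pose d := (t ^+ 2 - dot y^T y^T) / 4.
have AA : A *m A = t *: A - d%:M.
  by apply: mx2_eq; rewrite mul2E !mxE /d /dot !mxE /=; field: (sqrCi C).
(* Move [A *m A] across [K k] in two ways: by two commutations, and after Cayley-Hamilton (trace
   [t], determinant [d]) has reduced it to degree one. Multiplying by [adj (K k)] and summing then
   makes a multiple of [A] scalar; as [y] is nonzero, that multiple is 0 and [t = 0]. *)
have comm2 k : (t * a * (1 - a)) *: (K k *m A) = (d * (1 - a ^+ 2)) *: K k.
  have e1 : A *m A *m K k = a ^+ 2 *: (K k *m (A *m A)).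
    by rewrite -mulmxA comm -scalemxAr [A *m (K k *m A)]mulmxA comm -scalemxAl scalerA -expr2 -mulmxA.
  rewrite AA mulmxBl mulmxBr -scalemxAl comm -scalemxAr mul_scalar_mx mul_mx_scalar in e1.
  rewrite scalerBr !scalerA in e1.
  apply: (eq_by_sub _ e1); move: (K k *m A) => B.
  by apply/matrixP => i j; rewrite !mxE; ring.
have key : (t * a * (1 - a)) *: A = (d * (1 - a ^+ 2))%:M.
  rewrite -[A]mul1mx -hK.2 mulmx_suml scaler_sumr -[RHS]mulmx1 -hK.2 mulmx_sumr.
  apply: eq_bigr => k _; rewrite -mulmxA scalemxAr comm2 -scalemxAr.
  by rewrite mul_scalar_mx.
have yT0 : y^T != 0 by rewrite -(inj_eq trmx_inj) trmxK trmx0.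
have t0 : t = 0.
  have : (t * a * (1 - a)) *: y^T = 0.
    have := congr1 (@bx C) key; rewrite pvZ bx_pv => ->.
    by rewrite bxE; apply: col3_eq; rewrite !mxE /=; ring.
  move/eqP; rewrite scaler_eq0 (negPf yT0) orbF !mulf_eq0 (negPf a0) orbF.
  by rewrite subr_eq0 [1 == a]eq_sym (negPf na1) orbF => /eqP.
have : d * (1 - a ^+ 2) = 0.
  have := congr1 mxtrace key; rewrite t0 !mul0r scale0r mxtrace0 mxtrace_scalar.
  by move/esym/eqP; rewrite mulrn_eq0 /= => /eqP.
move/eqP; rewrite mulf_eq0 => /orP [/eqP d0|]; last first.
  rewrite subr_eq0 eq_sym sqrf_eq1 (negPf na1) /= => /eqP ->; by left.
have A0 : A != 0.
  apply: contra_neq yT0 => A0; rewrite -(bx_pv t y^T) -/A A0 bxE.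
  by apply: col3_eq; rewrite !mxE /=; ring.
(* In this branch [A] is a nonzero nilpotent matrix: its kernel is the line spanned by any nonzero
   column, and commutation shows that every [K k] preserves that line. *)
have AA0 : A *m A = 0 by rewrite AA d0 t0 scale0r -scalemx1 scale0r subrr.
have [j Aj] : exists j, col j A != 0.
  have [h|h] := eqVneq (col i0 A) 0; last by exists i0.
  exists i1; apply: contra_neq A0 => h'; move: h h' => /colP h /colP h'.
  by apply: mx2_eq; [have := h i0|have := h' i0|have := h i1|have := h' i1]; rewrite !mxE.
have Aw : A *m col j A = 0 by rewrite colE mulmxA AA0 mul0mx.
right; apply: (common_eigenvector_pure Aj) => k; apply: (kernel_line A0 Aj Aw).
by rewrite mulmxA comm -scalemxAl -mulmxA Aw mulmx0 scaler0.
Qed.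

End FixedPoints.

(** * Decay of matrix powers and channels close to an interior constant *)

Section Decay.
Set Implicit Arguments.
Unset Strict Implicit.
Variable C : archiClosedFieldType.
Implicit Types (M : 'M[C]_3) (c r x : 'cV[C]_3) (X : 'M[C]_2) (u : nat -> C).

Definition geometric_decay u :=
  exists k q, [/\ 0 <= k, 0 < q, q < 1 & forall n, `|u n| <= k * q ^+ n].

Lemma geometric_decay_rec u (a : C) : `|a| < 1 ->
  geometric_decay (fun n => u n.+1 - a * u n) -> geometric_decay u.
Proof.
move=> a1 [k [q [k0 q0 q1 hu]]].
pose p := 1 - q; pose b := 1 - `|a|.
have p0 : 0 < p by rewrite subr_gt0.
have b0 : 0 < b by rewrite subr_gt0.
have p1 : p <= 1 by rewrite lerBlDr lerDl ltW.
have b1 : b <= 1 by rewrite lerBlDr lerDl.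
have h2 : (0 : C) < 2^-1 by rewrite invr_gt0 ltr0n.
have h21 : 2^-1 < 1 :> C by rewrite invf_lt1 ?ltr0n // ltr1n.
(* A rate below 1 that is at least [q] and strictly larger than [|a|], also when these two
   coincide. *)
pose q' := 1 - p * b / 2.
have pb : 0 < p * b / 2 by rewrite !mulr_gt0.
have qq' : q <= q'.
  rewrite -subr_ge0 (_ : q' - q = p * (1 - b / 2)); last by rewrite /q' /p; ring.
  rewrite mulr_ge0 ?(ltW p0) // subr_ge0 (le_trans _ (ltW h21)) //.
  by rewrite ler_piMl // ltW.
have aq' : 0 < q' - `|a|.
  rewrite (_ : q' - `|a| = b * (1 - p / 2)); last by rewrite /q' /b; ring.
  rewrite mulr_gt0 // subr_gt0 (le_lt_trans _ h21) //.
  by rewrite ler_piMl // ltW.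
have q'0 : 0 < q' by apply: lt_le_trans qq'.
(* Chosen so that [|a| k' + k <= q' k'], which is the induction step. *)
pose k' := `|u 0%N| + k / (q' - `|a|).
have kk' : k / (q' - `|a|) <= k' by rewrite lerDr.
have k'0 : 0 <= k' by rewrite addr_ge0 // divr_ge0 // ltW.
exists k', q'; split=> //; first by rewrite gtrDl oppr_lt0.
elim=> [|n IH]; first by rewrite expr0 mulr1 lerDl divr_ge0 // ltW.
have -> : u n.+1 = a * u n + (u n.+1 - a * u n) by ring.
apply: le_trans (ler_normD _ _) _; rewrite normrM.
apply: (@le_trans _ _ (`|a| * (k' * q' ^+ n) + k * q' ^+ n)).
  rewrite lerD ?ler_wpM2l //; apply: le_trans (hu n) _; rewrite ler_wpM2l //.
  by apply: lerXn2r; rewrite ?nnegrE /= ?(ltW q0) ?(ltW q'0).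
have -> : `|a| * (k' * q' ^+ n) + k * q' ^+ n = (`|a| * k' + k) * q' ^+ n by ring.
rewrite exprS mulrA ler_wpM2r ?exprn_ge0 ?(ltW q'0) //.
rewrite ler_pdivrMr // -subr_ge0 in kk'; rewrite -subr_ge0; move: kk'.
by congr (0 <= _); ring.
Qed.

Lemma bernoulli (h : C) n : 0 <= h -> 1 + h *+ n <= (1 + h) ^+ n.
Proof.
move=> h0; elim: n => [|n IH]; first by rewrite mulr0n addr0 expr0.
rewrite exprS; apply: (@le_trans _ _ ((1 + h) * (1 + h *+ n))).
  rewrite mulrS -subr_ge0.
  have -> : (1 + h) * (1 + h *+ n) - (1 + (h + h *+ n)) = h * (h *+ n) by ring.
  by rewrite mulr_ge0 // mulrn_wge0.
by rewrite ler_wpM2l // addr_ge0.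
Qed.

(** This is where the archimedean property enters: with [h = 1/q - 1], Bernoulli gives growth of
    [q ^- n] at least linear in [n], and an integer above [k / (e h)] suffices. *)
Lemma geometric_decay_small u (e : C) : geometric_decay u -> 0 < e ->
  exists N, forall n, (N <= n)%N -> `|u n| <= e.
Proof.
move=> [k [q [k0 q0 q1 hu]]] e0; pose h := q^-1 - 1.
have h0 : 0 < h by rewrite subr_gt0 invf_gt1.
have t0 : 0 <= k / (e * h) by rewrite divr_ge0 // ltW // mulr_gt0.
exists (Num.bound (k / (e * h))) => n ln; apply: le_trans (hu n) _.
have := archi_boundP t0; set N := Num.bound _ in ln * => lN.
have qn0 : 0 < q ^+ n by rewrite exprn_gt0.
rewrite -ler_pdivlMr // -exprVn.
have -> : q^-1 = 1 + h by rewrite addrC subrK.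
apply: le_trans (_ : e * (1 + h *+ n) <= _); last first.
  by rewrite ler_wpM2l ?(ltW e0) // bernoulli // ltW.
rewrite ltr_pdivrMr ?mulr_gt0 // in lN; apply: le_trans (ltW lN) _.
rewrite mulrCA ler_wpM2l ?(ltW e0) // -[h *+ n]mulr_natl //.
by apply: ler_wpDl => //; rewrite ler_wpM2r ?(ltW h0) // ler_nat.
Qed.

(** Peeling one root [a] off the annihilating polynomial replaces [P] by [(A - a) P], and the
    sequence for [P] satisfies a first-order recurrence driven by that one. Carrying [P] along
    avoids the Jordan form. *)
Lemma annihilated_decay n (A : 'M[C]_n.+1) (rs : seq C) (P : 'M[C]_n.+1) i j :
  all (fun a => `|a| < 1) rs ->
  horner_mx A (\prod_(a <- rs) ('X - a%:P)) *m P = 0 ->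
  geometric_decay (fun k => (A ^+ k *m P) i j).
Proof.
elim: rs P => [|a rs IH] P /=.
  rewrite big_nil rmorph1 mul1mx => _ ->; exists 0, 2^-1.
  split=> //; rewrite ?invr_gt0 ?ltr0n ?invf_lt1 ?ltr1n // => k.
  by rewrite mulmx0 mxE normr0 mul0r.
case/andP => a1 hrs; rewrite big_cons mulrC rmorphM /= rmorphB /= horner_mx_X horner_mx_C.
rewrite -mulmxA => /(IH _ hrs) d.
apply: (geometric_decay_rec a1); case: d => k [q [k0 q0 q1 hq]].
exists k, q; split=> // l; have := hq l.
rewrite mulmxBl mulmxBr mul_scalar_mx -scalemxAr mulmxA !mxE.
by rewrite (_ : A ^+ l *m A = A ^+ l.+1) // exprSr.
Qed.

Lemma power_decay n (A : 'M[C]_n.+1) i j :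
  (forall a, eigenvalue A a -> `|a| < 1) -> geometric_decay (fun k => (A ^+ k) i j).
Proof.
move=> hA; have [rs ers] := closed_field_poly_normal (char_poly A).
rewrite (monicP (char_poly_monic A)) scale1r in ers.
have := @annihilated_decay n A rs 1%:M i j; rewrite -ers.
have -> : horner_mx A (char_poly A) = 0 by apply: Cayley_Hamilton.
rewrite mul0mx; case/(_ _ erefl) => [|k [q [k0 q0 q1 h]]].
  apply/allP => a ars; apply: hA.
  by rewrite eigenvalue_root_char ers root_prod_XsubC.
by exists k, q; split=> // l; have := h l; rewrite mulmx1.
Qed.

Lemma weighted_measure_prepare (phi : 'M[C]_2 -> 'M[C]_2) m (p : 'I_m -> C)
    (f : 'I_m -> 'cV[C]_2) (R : 'I_m -> 'M[C]_2) :
  (forall k, 0 <= p k) -> (forall k, is_state (R k)) ->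
  (forall X, phi X = \sum_k (p k * (adj (f k) *m X *m f k) 0 0) *: R k) ->
  measure_prepare phi.
Proof.
move=> p0 sR e; exists m, (fun k => sqrtC (p k) *: f k), R; split=> // X.
rewrite e; apply: eq_bigr => k _; congr (_ *: _).
have rs : (sqrtC (p k))^* = sqrtC (p k) by apply/CrealP/ger0_real; rewrite sqrtC_ge0.
rewrite ctrmxZ rs -!scalemxAl -scalemxAr scalerA [RHS]mxE.
by rewrite -expr2 sqrtCK.
Qed.

Definition axis (k : 'I_6) : 'cV[C]_3 :=
  match val k with
  | 0 => col3 1 0 0 | 1 => col3 (-1) 0 0 | 2 => col3 0 1 0
  | 3 => col3 0 (-1) 0 | 4 => col3 0 0 1 | _ => col3 0 0 (-1)
  end%N.

(** The four horizontal vectors have squared norm 2 and the two vertical ones norm 1; the weights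
    make all six effects equal to [(1 +- sigma_j)/6]. *)
Definition axis_weight (k : 'I_6) : C := if (val k < 4)%N then 6^-1 else 3^-1.

Definition col2 (a b : C) : 'cV[C]_2 := \col_i if val i == 0%N then a else b.

Definition axis_vector (k : 'I_6) : 'cV[C]_2 :=
  match val k with
  | 0 => col2 1 1 | 1 => col2 1 (-1) | 2 => col2 1 'i
  | 3 => col2 1 (- 'i) | 4 => col2 1 0 | _ => col2 0 1
  end%N.

(* Measure with the six effects (1 +- sigma_j)/6 and prepare c +- 3 M e_j. *)
Lemma measure_prepare_axes M c :
  (forall k, real_mx (c + 3 *: (M *m axis k))) ->
  (forall k, dot (c + 3 *: (M *m axis k)) (c + 3 *: (M *m axis k)) <= 1) ->
  measure_prepare (bloch_map M c).
Proof.
move=> rk lk; apply: (@weighted_measure_prepare _ _ axis_weight axis_vector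
  (fun k => pv 1 (c + 3 *: (M *m axis k)))) => [k|k|X].
- by rewrite /axis_weight; case: ifP => _; rewrite invr_ge0 ler0n.
- exact: state_pv.
rewrite bloch_mapE bxE tr2 !big_ord_recl big_ord0 addr0.
have cNi : (- 'i)^* = 'i :> C by rewrite rmorphN /= conjCi opprK.
rewrite !quad2E /axis_weight /axis_vector /axis /= !mxE /= rmorph1 rmorphN rmorph1 conjCi conjC0 cNi.
(* With trace [T] and Bloch vector [x], the two outcomes of axis [j] contribute
   [T c / 3 + x_j M e_j]; the factor 3 in the prepared vectors compensates the sixths. *)
rewrite !pvZ !pvD; congr pv; first by field: (sqrCi C).
by apply: col3_eq; rewrite ?(mul3E, mxE) /=; field: (sqrCi C).
Qed.

Lemma axis_real k : real_mx (axis k).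
Proof.
move=> i j; rewrite /axis.
by case: (val k) => [|[|[|[|[]]]]] *; rewrite mxE; case: (val i) => [|[]] *;
  rewrite ?rpredN ?rpred0 ?rpred1.
Qed.

Lemma axis_unit k : dot (axis k) (axis k) = 1.
Proof.
rewrite /axis /dot; case: (val k) => [|[|[|[|[]]]]] *; rewrite !mxE /=; ring.
Qed.

Lemma coord_le1 r i : real_mx r -> dot r r <= 1 -> `|r i 0| <= 1.
Proof.
move=> rr lr; rewrite -ler_sqr ?nnegrE ?ler01 // real_normK ?rr // expr1n.
apply: le_trans lr.
have sq j : 0 <= r j 0 * r j 0 by rewrite -expr2 real_exprn_even_ge0 ?rr.
move: i; rewrite /dot; apply: all_ord3; rewrite expr2.
- by rewrite -addrA lerDl addr_ge0.
- by rewrite addrAC lerDr addr_ge0.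
by rewrite lerDr addr_ge0.
Qed.

Lemma ler_norm_sum3 (a0 a1 a2 e : C) : `|a0| <= e -> `|a1| <= e -> `|a2| <= e ->
  `|a0 + a1 + a2| <= 3 * e.
Proof.
move=> h0 h1 h2; have -> : 3 * e = e + e + e by ring.
apply: le_trans (ler_normD _ _) _; rewrite lerD //.
by apply: le_trans (ler_normD _ _) _; rewrite lerD.
Qed.

(** Here 504 is [2 * 36 + 432]: three coordinates give [r.x <= 36 e], and
    [x.x <= 3 * 144 e^2 <= 432 e] since [e <= 1]. *)
Lemma interior_perturbation r x (e : C) : real_mx r -> real_mx x -> 0 <= e -> e <= 1 ->
  dot r r <= 1 - 504 * e -> (forall i, `|x i 0| <= 12 * e) -> dot (r + x) (r + x) <= 1.
Proof.
move=> rr rx e0 e1 lr hx.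
have lr1 : dot r r <= 1 by apply: le_trans lr _; rewrite lerBlDr lerDl mulr_ge0.
have hr i := coord_le1 i rr lr1.
have b1 : dot r x <= 36 * e.
  apply: le_trans (real_ler_norm (real_dot rr rx)) _.
  rewrite (_ : 36 * e = 3 * (12 * e)); last by ring.
  have h i : `|r i 0 * x i 0| <= 12 * e.
    by rewrite normrM; apply: le_trans (hx i); rewrite ler_piMl.
  exact: ler_norm_sum3.
have b2 : dot x x <= 432 * e.
  apply: le_trans (real_ler_norm (real_dot rx rx)) _.
  rewrite (_ : 432 * e = 3 * (144 * e)); last by ring.
  have h i : `|x i 0 * x i 0| <= 144 * e.
    rewrite normrM; apply: (@le_trans _ _ (12 * e * (12 * e))).
      by rewrite ler_pM.
    rewrite (_ : 12 * e * (12 * e) = 144 * e * e); last by ring.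
    by rewrite ler_piMr // mulr_ge0.
  exact: ler_norm_sum3.
rewrite dotDl !dotDr [dot x r]dotC.
rewrite (_ : _ + _ = dot r r + (2 * dot r x + dot x x)); last by ring.
have b3 : 2 * dot r x + dot x x <= 504 * e.
  rewrite (_ : 504 * e = 2 * (36 * e) + 432 * e); last by ring.
  by rewrite lerD // ler_wpM2l.
by rewrite -lerBrDr (le_trans lr) // lerD2l lerN2.
Qed.

Lemma measure_prepare_ext (phi psi : 'M[C]_2 -> 'M[C]_2) :
  phi =1 psi -> measure_prepare phi -> measure_prepare psi.
Proof.
by move=> e [m [f [R [sR h]]]]; exists m, f, R; split=> // X; rewrite -e.
Qed.

Lemma iter_shift_fixed M c r n : M *m r + c = r -> M ^+ n *m r + iter_shift M c n = r.
Proof.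
move=> er; elim: n => [|n IH] /=; first by rewrite mul1mx addr0.
rewrite exprS (_ : M * M ^+ n = M *m M ^+ n) // -mulmxA addrA -mulmxDr IH.
exact: er.
Qed.

Lemma real_mxX M n : real_mx M -> real_mx (M ^+ n).
Proof.
move=> rM; elim: n => [|n IH]; last by rewrite exprS; apply: real_mxM.
by move=> i j; rewrite mxE rpred_nat.
Qed.

Lemma decaying_measure_prepare M c r :
  real_mx M -> real_mx c -> real_mx r -> dot r r < 1 -> M *m r + c = r ->
  (forall a, eigenvalue M a -> `|a| < 1) ->
  exists2 n, (0 < n)%N & measure_prepare (iter n (bloch_map M c)).
Proof.
move=> rM rc rr lr er hM.
pose e := (1 - dot r r) / 504.
have e0 : 0 < e by rewrite divr_gt0 ?subr_gt0 ?ltr0n.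
have [N hN] : exists N : 'I_3 -> 'I_3 -> nat,
    forall i j n, (N i j <= n)%N -> `|(M ^+ n) i j| <= e.
  have h i j : exists N, forall n, (N <= n)%N -> `|(M ^+ n) i j| <= e.
    exact: geometric_decay_small (power_decay i j hM) e0.
  have /fin_all_exists [N hN] : forall i, exists N : 'I_3 -> nat,
    forall j n, (N j <= n)%N -> `|(M ^+ n) i j| <= e.
    by move=> i; exact: fin_all_exists (h i).
  by exists N.
(* The sum dominates each of the nine thresholds, and the successor keeps the iterate positive. *)
pose n := (\sum_i \sum_j N i j).+1.
have small i j : `|(M ^+ n) i j| <= e.
  apply: hN; rewrite /n (bigD1 i) //= (bigD1 j) //= -addnA -addnS.
  exact: leq_addr.
exists n => //; apply: (@measure_prepare_ext _ _ (fun X => esym (iter_bloch M c n X))).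
have rP : real_mx (M ^+ n) by apply: real_mxX.
have es := iter_shift_fixed n er; set P := M ^+ n in small rP es *.
set s := iter_shift M c n in es *.
pose x k := P *m (3 *: axis k - r).
have rx k : real_mx (x k).
  apply: real_mxM => //; apply: real_mxD; last exact: real_mxN.
  by apply: real_mxZ; [rewrite rpred_nat | apply: axis_real].
(* Since [r] stays fixed, [s = r - P r], so each prepared vector differs from [r] by [P] applied to
   a vector with coordinates at most 4: three entries of size [e] give the bound [12 e]. *)
have ek k : s + 3 *: (P *m axis k) = r + x k.
  have -> : s = r - P *m r by rewrite -[X in X - _]es addrC addKr.
  by rewrite /x mulmxBr -scalemxAr -addrA [- _ + _]addrC.
have e1 : e <= 1.
  rewrite ler_pdivrMr ?ltr0n // mul1r lerBlDr.
  by rewrite (le_trans (_ : _ <= 504)) ?ler1n // lerDl dot_ge0.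
apply: measure_prepare_axes => k; rewrite ek; first exact: real_mxD.
apply: (interior_perturbation rr (rx k) (ltW e0) e1) => [|i].
  by rewrite /e mulrC divfK ?pnatr_eq0 // opprB addrC subrK.
rewrite /x mul3E (_ : 12 * e = 3 * (e * 4)); last by ring.
have h j : `|(3 *: axis k - r) j 0| <= 4.
  rewrite !mxE; apply: le_trans (ler_normB _ _) _.
  rewrite (_ : 4 = 3 * 1 + 1); last by ring.
  rewrite lerD ?coord_le1 ?(ltW lr) // normrM normr_nat ler_wpM2l //.
  by rewrite coord_le1 ?axis_unit //; apply: axis_real.
by apply: ler_norm_sum3; rewrite normrM ler_pM.
Qed.

End Decay.

(** * The normal forms save entanglement, and the equivalence *)

Section Saving.
Set Implicit Arguments.
Unset Strict Implicit.
Variable C : archiClosedFieldType.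
Implicit Types (M O T : 'M[C]_3) (c r x y u v : 'cV[C]_3).

Lemma dot_mulmx x y : dot x y = (x^T *m y) 0 0.
Proof. by rewrite mul3E !mxE. Qed.

Lemma dot_orthogonal O x y : O^T *m O = 1%:M -> dot (O *m x) (O *m y) = dot x y.
Proof.
by move=> oO; rewrite !dot_mulmx trmx_mul -mulmxA (mulmxA O^T) oO mul1mx.
Qed.

Lemma conj_act O T x : O^T *m O = 1%:M -> O *m T *m O^T *m (O *m x) = O *m (T *m x).
Proof. by move=> oO; rewrite -!mulmxA (mulmxA O^T) oO mul1mx. Qed.

Lemma eigen_expr M v (a : C) n : M *m v = a *: v -> M ^+ n *m v = a ^+ n *: v.
Proof.
move=> e; elim: n => [|n IH]; first by rewrite mul1mx scale1r.
by rewrite exprSr -mulmxA e -scalemxAr IH scalerA -exprS.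
Qed.

Lemma eb_iter_pure_output M c r s u v n : entanglement_breaking (iter n (bloch_map M c)) ->
  real_mx r -> real_mx s -> dot r r = 1 -> dot s s = 1 ->
  M ^+ n *m r + iter_shift M c n = s ->
  dot u s = 0 -> dot v r = 0 -> dot u (M ^+ n *m v) = 0.
Proof.
move=> eb; apply: eb_pure_output.
by apply: (eb_ext _ eb) => X; rewrite iter_bloch.
Qed.

Lemma real_e3 : real_mx (e3 C).
Proof. by move=> i j; rewrite mxE; case: (val i) => [|[]] *; rewrite ?rpred0 ?rpred1. Qed.

Lemma e3_unit : dot (e3 C) (e3 C) = 1.
Proof. by rewrite /dot !mxE /=; ring. Qed.

(** The vector [(1, i, 0)] diagonalises the rotation block with eigenvalue [z = lam (ct + i st)],
    and pairs to 2 with its conjugate under the bilinear [dot]. Were the [n]-th iterate breaking,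
    [2 z ^+ n] would vanish, although [ct + i st] divides [ct^2 + st^2 = 1]. *)
Lemma fixing_form_saving M c : fixing_form M c -> entanglement_saving (bloch_map M c).
Proof.
move=> [O [ct [st [lam [mu [al [[rO [oO _]] rc rs e1 [/andP [l0 _] _ _ eM ec]]]]]]]] n _ eb.
pose v := O *m col3 1 'i 0; pose u := O *m col3 1 (- 'i) 0; pose r := O *m e3 C.
pose z := lam * (ct + 'i * st).
have ev : M *m v = z *: v.
  rewrite /v eM conj_act // scalemxAr; congr (_ *m _).
  by apply: col3_eq; rewrite mul3E !mxE /z /=; ring: (sqrCi C).
have er : M *m r + c = r.
  rewrite /r eM ec conj_act // -mulmxDr; congr (_ *m _).
  by apply: col3_eq; rewrite mxE mul3E !mxE /=; ring.
have rr : real_mx r by apply: real_mxM rO real_e3.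
have r1 : dot r r = 1 by rewrite dot_orthogonal // e3_unit.
have ur : dot u r = 0 by rewrite dot_orthogonal // /dot !mxE /=; ring.
have vr : dot v r = 0 by rewrite dot_orthogonal // /dot !mxE /=; ring.
have uv : dot u v = 2 by rewrite dot_orthogonal // /dot !mxE /=; ring: (sqrCi C).
have := eb_iter_pure_output eb rr rr r1 r1 (iter_shift_fixed n er) ur vr.
rewrite (eigen_expr n ev) dotZr uv => /eqP.
rewrite mulf_eq0 pnatr_eq0 orbF expf_eq0 => /andP [_].
rewrite mulf_eq0 gt_eqF //= => /eqP z0.
have := oner_neq0 C; rewrite -e1.
have -> : ct ^+ 2 + st ^+ 2 = (ct + 'i * st) * (ct - 'i * st) by ring: (sqrCi C).
by rewrite z0 mul0r eqxx.
Qed.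

Lemma swapping_form_saving M c : swapping_form M c -> entanglement_saving (bloch_map M c).
Proof.
move=> [-> [O [ct [st [lam [[rO [oO _]] rc rs e1 [/andP [l0 _] eM]]]]]]] n _ eb.
(* The horizontal block is [lam] times a reflection, whose mirror direction is [(1 + ct, st)], at
   half the angle. This vector is zero exactly for [ct = -1], where [(0, 1)] is used. *)
have [p [p0 pz ep]] : exists p : 'cV[C]_3, [/\ dot p p != 0, dot p (e3 C) = 0 &
    M *m (O *m p) = lam *: (O *m p)].
  have e1' : ct * ct = 1 - st * st by apply: (eq_by_sub _ e1); ring.
  have [c1|c1] := eqVneq (1 + ct) 0.
    have ct1 : ct = -1 by apply: (eq_by_sub _ c1); ring.
    have st0 : st = 0.
      by apply/eqP; rewrite -sqrf_eq0; apply/eqP; apply: (eq_by_sub _ e1);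
        rewrite ct1; ring.
    exists (col3 0 1 0); split.
    - by rewrite /dot !mxE /= !(mulr0, mulr1, add0r, addr0) oner_neq0.
    - by rewrite /dot !mxE /=; ring.
    rewrite eM conj_act // scalemxAr; congr (_ *m _).
    by apply: col3_eq; rewrite mul3E !mxE /= ?st0 ?ct1; ring.
  exists (col3 (1 + ct) st 0); split.
  - rewrite (_ : dot _ _ = 2 * (1 + ct)); last by rewrite /dot !mxE /=; ring: e1'.
    by rewrite mulf_neq0 // pnatr_eq0.
  - by rewrite /dot !mxE /=; ring.
  rewrite eM conj_act // scalemxAr; congr (_ *m _).
  by apply: col3_eq; rewrite mul3E !mxE /=; ring: e1'.
pose r := O *m e3 C.
have er : M *m r = (-1) *: r.
  rewrite /r eM conj_act // scalemxAr; congr (_ *m _).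
  by apply: col3_eq; rewrite mul3E !mxE /=; ring.
have en : M ^+ n *m r + iter_shift M 0 n = (-1) ^+ n *: r.
  rewrite (eigen_expr n er); have -> : iter_shift M 0 n = 0; last by rewrite addr0.
  by elim: (n) => //= k ->; rewrite mulmx0 addr0.
have rr : real_mx r by apply: real_mxM rO real_e3.
have r1 : dot r r = 1 by rewrite dot_orthogonal // e3_unit.
have rs' : real_mx ((-1) ^+ n *: r).
  by apply: real_mxZ => //; rewrite rpredX // rpredN rpred1.
have s1 : dot ((-1) ^+ n *: r) ((-1) ^+ n *: r) = 1.
  by rewrite dotZl dotZr r1 mulr1 -exprMn mulrNN mulr1 expr1n.
have pr : dot (O *m p) r = 0 by rewrite dot_orthogonal.
have pr' : dot (O *m p) ((-1) ^+ n *: r) = 0 by rewrite dotZr pr mulr0.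
have := eb_iter_pure_output eb rr rs' r1 s1 en pr' pr.
rewrite (eigen_expr n ep) dotZr dot_orthogonal // => /eqP.
by rewrite mulf_eq0 (negPf p0) orbF expf_eq0 gt_eqF // andbF.
Qed.

Lemma saving_normal_form M c : real_mx M -> real_mx c ->
  completely_positive (bloch_map M c) -> entanglement_saving (bloch_map M c) ->
  fixing_form M c \/ swapping_form M c.
Proof.
move=> rM rc /cp_kraus [m [K hK]] es.
have nmp : ~ measure_prepare (bloch_map M c).
  by move/measure_prepare_eb; apply: (es 1%N).
have pure_case : (exists r, pure_fixed_point M c r) -> fixing_form M c \/ swapping_form M c.
  by case=> r /(kraus_pure_fixed_point hK) [/nmp|]; [|left].
have [/pure_case //|[r [rr lr er]]] := pure_or_interior_fixed_point rM rc hK.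
(* Listing the eigenvalues makes the test whether all have modulus below 1 a boolean case
   distinction. *)
have [rs ers] := closed_field_poly_normal (char_poly M).
rewrite (monicP (char_poly_monic M)) scale1r in ers.
have eigE a : eigenvalue M a = (a \in rs).
  by rewrite eigenvalue_root_char ers root_prod_XsubC.
have [/allP hall|/allPn [a ars na]] := boolP (all (fun a => `|a| < 1) rs).
  have [|n n0 mp] := decaying_measure_prepare rM rc rr lr er.
    by move=> a; rewrite eigE; apply: hall.
  by case: (es n n0); apply: measure_prepare_eb.
rewrite -real_leNgt ?normr_real ?rpred1 // in na.
have /eigenvalueP [y ey y0] : eigenvalue M a by rewrite eigE.
have [ea|/pure_case //] := peripheral_eigenvalue rM hK rr lr er y0 ey na.
(* The eigenvalue -1 comes with a left, possibly complex eigenvector; singularity of [1 + M]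
   converts it into a right one, which is then made real and normalised to the reversed axis. *)
have sing : (1%:M + M) \notin unitmx.
  rewrite unitmxE unitfE negbK; apply/det0P; exists y => //.
  by rewrite mulmxDr mulmx1 ey ea scaleN1r subrr.
have [x x0 ex] := singular_kernel sing.
have ex' : M *m x = -1 *: x.
  by apply/eqP; rewrite scaleN1r -addr_eq0 addrC -{1}[x]mul1mx -mulmxDl ex.
have rN1 : (-1 : C) \is Num.real by rewrite rpredN rpred1.
have [w [rw w0 ew]] := real_eigenvector rM rN1 x0 ex'.
have [N [_ _ rn n1]] := normalize rw w0.
have en : M *m (N^-1 *: w) = - (N^-1 *: w).
  by rewrite -scalemxAr ew scaleN1r scalerN.
by case: (kraus_reversed_axis hK rn n1 en) => [/nmp|]; [|right].
Qed.

End Saving.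

Theorem mainTheorem12 (C : archiClosedFieldType) (M : 'M[C]_3) (c : 'cV[C]_3)
    (HMreal : real_mx M) (Hcreal : real_mx c)
    (HCP : completely_positive (bloch_map M c))
    (HTP : trace_preserving (bloch_map M c)) :
  entanglement_saving (bloch_map M c) <->
  (exists (O : 'M[C]_3) (ct st lam mu al : C),
      [/\ SO3 O, ct \is Num.real, st \is Num.real, ct ^+ 2 + st ^+ 2 = 1 &
       [/\ 0 < lam <= 1, lam ^+ 2 <= mu <= 1,
           0 <= al /\ al ^+ 2 <= (1 - mu) * (mu - lam ^+ 2),
           M = O *m mk3 (lam * ct) (lam * st) al
                        (- (lam * st)) (lam * ct) 0
                        0 0 mu *m O^T &
           c = O *m col3 (- al) 0 (1 - mu)]])
  \/
  (c = 0 /\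
   exists (O : 'M[C]_3) (ct st lam : C),
      [/\ SO3 O, ct \is Num.real, st \is Num.real, ct ^+ 2 + st ^+ 2 = 1 &
       [/\ 0 < lam <= 1 &
           M = O *m mk3 (lam * ct) (lam * st) 0
                        (lam * st) (- (lam * ct)) 0
                        0 0 (-1) *m O^T]]).
Proof.
split; first exact: saving_normal_form.
by case; [apply: fixing_form_saving | apply: swapping_form_saving].
Qed.
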